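(* There exists a constant $c_1>0$ such that for every $n\ge 1$ the random rational lemniscate $\Gamma$ of degree $n$ satisfies $$c_1\,n\le\mathbb E\,b_0(\Gamma)\le n,$$ where $b_0(\Gamma)$ denotes the number of connected components of $\Gamma$.
   Context: The random rational lemniscate of degree $n$ is $\Gamma=\{z\in\hat{\mathbb C}:|p(z)/q(z)|=1\}$, where $\hat{\mathbb C}=\mathbb C\cup\{\infty\}$ is the Riemann sphere, $p(z)=\sum_{k=0}^na_kz^k$ and $q(z)=\sum_{k=0}^nb_kz^k$, and $a_0,\dots,a_n,b_0,\dots,b_n$ are independent centered complex Gaussian random variables with $\mathbb E\,a_j\overline{a_k}=\delta_{jk}\binom nk$ and $\mathbb E\,b_j\overline{b_k}=\delta_{jk}\binom nk$. *)

(* Defs.v *)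
From mathcomp Require Import all_boot all_order all_algebra.
From mathcomp Require Import all_classical all_reals all_analysis.
From mathcomp Require Import complex.

Set Implicit Arguments.
Unset Strict Implicit.
Unset Printing Implicit Defensive.

Import Order.TTheory GRing.Theory Num.Theory.
Import numFieldNormedType.Exports.

Local Open Scope classical_set_scope.
Local Open Scope ring_scope.
Local Open Scope complex_scope.

(* MathComp-Analysis attaches its norm topology to abstract numeric fields, not
   to the concrete type [R[i]]; the topology of C is found through this alias.
   Moduli [`|z|] are values in C (namely nonnegative reals). *)
Definition Cplx (R : realType) : numClosedFieldType := R[i].

Definition riemann_sphere (R : realType) : topologicalType :=
  one_point_compactification (Cplx R).

(* Value of the rational function p/q at a point of the sphere, once common
   factors have been cancelled. At infinity it is the quotient of the
   coefficients of degree d, where d is the larger of the two degrees. Since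
   x / 0 = 0, this returns 0 instead of infinity at a pole; both values have
   modulus different from 1. It is also 0 everywhere if q = 0. *)
Definition ratfun_val (R : realType) (p q : {poly Cplx R})
    (z : riemann_sphere R) : Cplx R :=
  let p1 := p %/ gcdp p q in
  let q1 := q %/ gcdp p q in
  match z with
  | Some x => p1.[x] / q1.[x]
  | None => let d := (maxn (size p1) (size q1)).-1 in p1`_d / q1`_d
  end.

Definition lemniscate (R : realType) (p q : {poly Cplx R}) :
    set (riemann_sphere R) :=
  [set z | `|ratfun_val p q z| = 1].

(* +oo if there are infinitely many components. *)
Definition num_components (R : realType) (X : topologicalType) (A : set X) :
    \bar R :=
  counting (connected_component A @` A).

Section complex_random_variables.
Context (R : realType) (d : measure_display) (T : measurableType d).
Variable P : probability T R.
Implicit Types (Z : T -> Cplx R).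

(* A complex random variable as a map into the measurable space R * R. *)
Definition real_pair Z (w : T) : R * R := (complex.Re (Z w), complex.Im (Z w)).

Definition complex_expectation Z : Cplx R :=
  fine 'E_P[fun w => complex.Re (Z w)] +i* fine 'E_P[fun w => complex.Im (Z w)].

(* Circularly symmetric, nondegenerate: the real and imaginary parts are
   independent and both have law N(0, s^2) for some s > 0 (the second parameter
   of normal_prob is the standard deviation). *)
Definition centered_complex_gaussian Z : Prop :=
  measurable_fun setT (real_pair Z) /\
  exists2 s : R, 0 < s &
    forall A B : set R, measurable A -> measurable B ->
      P (real_pair Z @^-1` (A `*` B))
      = (normal_prob 0 s A * normal_prob 0 s B)%E.

Definition mutually_independent (I : finType) (Z : I -> T -> Cplx R) : Prop :=
  forall (J : {set I}) (A : I -> set (R * R)),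
    (forall i, measurable (A i)) ->
    P (\bigcap_(i in [set` J]) (real_pair (Z i) @^-1` A i))
    = (\prod_(i in J) P (real_pair (Z i) @^-1` A i))%E.

End complex_random_variables.

Definition family_pair (I J U : Type) (a : I -> U) (b : J -> U) (k : I + J) : U :=
  match k with inl i => a i | inr j => b j end.

Definition random_poly (R : realType) (T : Type) (n : nat)
    (a : 'I_n.+1 -> T -> Cplx R) (w : T) : {poly Cplx R} :=
  \sum_(k < n.+1) a k w *: 'X^k.

(* Main.v *)
From HB Require Import structures.
Require Import Defs.
From mathcomp Require Import all_boot all_order all_algebra.
From mathcomp Require Import all_classical all_reals all_analysis.
From mathcomp Require Import measurable_realfun complex ring lra.
Set Implicit Arguments.
Unset Strict Implicit.
Unset Printing Implicit Defensive.
Import Order.TTheory GRing.Theory Num.Theory.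
Import numFieldNormedType.Exports.
Local Open Scope classical_set_scope.
Local Open Scope ring_scope.

(** The two bounds have unrelated proofs.

    Upper bound: it holds for every pair of polynomials of degree at most [n]
    ([lemniscate_num_components_le]). In lowest terms, p/q is a rational map of
    some degree d <= n. If d = 0 it is constant, and the lemniscate is empty or
    the whole sphere, which is connected. If d > 0 the map is open
    ([maps_to_open]) and its graph is closed ([maps_to_closed]). Hence a
    nonempty relatively clopen part of the lemniscate has an image in the unit
    circle that is open and closed, so it is mapped onto the circle and meets
    the fibre of 1 ([rel_clopen_hits_fibre]). This fibre has at most d points,
    and every component contains one of them ([component_meets]).

    Lower bound: call a disc good if |p| < |q| at its centre and |q| < |p| on
    its boundary. A good disc contains a component of the lemniscate, so
    disjoint good discs give distinct components ([num_components_ge_good]). A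
    grid contains at least n/64 disjoint discs with centres in the closed unit
    disc and radii of order 1/sqrt n, and it suffices that each of them is good
    with a probability bounded below by a constant independent of n and of the
    centre ([good_event]): the expected number of good discs is the sum of these
    probabilities.

    The law of p and q is invariant under the rotations of the sphere; on the
    level of second moments this is [sum_local_basis]. Rotating the centre z0
    to the origin, with local coordinate u, and putting
    kap^2 = (1 + |z0|^2)^n, second moments show that each of the
    two random polynomials is, with probability at least 7/8, bounded by 7 kap
    on |u| <= rho = 1/(2 sqrt n)
    ([integral_noise], [weighted_sup]). If the deterministic polynomials
    15 kap and 180 kap ((1 + rho u)^n - 1) are added to q and p respectively,
    they dominate this noise and make the disc good ([good_disc_of_noise]).
    Their coefficient vectors have bounded norm with respect to the covariance
    ([norm_peak_q], [norm_peak_p]), so the Cameron-Martin formula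
    ([cameron_martin]) shows that the shift changes probabilities by a bounded
    factor only: the disc is good with probability at least
    exp(- log_cost) / 2. *)

(** * Topology of the plane and of the sphere *)

Section ComplexTopology.
Variable R : realType.
Local Notation C := (Cplx R).
Local Notation S2 := (riemann_sphere R).

Lemma ltcR0 (e : C) : 0 < e -> exists2 r : R, 0 < r & e = (r%:C)%C.
Proof.
case: e => a b; rewrite ltcE /= => /andP[/eqP b0 a0].
by exists a => //; rewrite b0.
Qed.

Lemma cplx_contD (T : topologicalType) (f g : T -> C) x :
  {for x, continuous f} -> {for x, continuous g} ->
  {for x, continuous (fun y => f y + g y)}.
Proof. by move=> cf cg; exact: (cvgD cf cg). Qed.

Lemma cplx_contB (T : topologicalType) (f g : T -> C) x :
  {for x, continuous f} -> {for x, continuous g} ->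
  {for x, continuous (fun y => f y - g y)}.
Proof. by move=> cf cg; exact: (cvgB cf cg). Qed.

Lemma cplx_contM (T : topologicalType) (f g : T -> C) x :
  {for x, continuous f} -> {for x, continuous g} ->
  {for x, continuous (fun y => f y * g y)}.
Proof. by move=> cf cg; exact: (cvgM cf cg). Qed.

Lemma cplx_cont_cst (T : topologicalType) (c : C) (x : T) : {for x, continuous (fun=> c)}.
Proof. exact: cvg_cst. Qed.

Lemma continuous_real_complex : continuous (fun t : R => (t%:C)%C : C).
Proof.
move=> t; apply/cvgrPdist_lt => e /ltcR0[r r0 ->].
near=> s; rewrite -(rmorphB (real_complex R)) normc_def /= expr0n /= addr0 sqrtr_sqr ltcR.
near: s; exact: (@cvgr_dist_lt _ _ _ (nbhs t) _ id t).
Unshelve. all: by end_near. Qed.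

Lemma continuous_complex_pair : continuous (fun v : R * R => (v.1 +i* v.2)%C : C).
Proof.
move=> v.
have -> : (fun v : R * R => (v.1 +i* v.2)%C : C) =
          (fun v => (v.1%:C)%C + (0 +i* 1)%C * (v.2%:C)%C).
  apply/funext => -[x y] /=; apply/eqP; rewrite eq_complex /=.
  by apply/andP; split; apply/eqP; ring.
apply: cvgD.
  apply: (@cvg_comp _ _ _ fst (fun t : R => (t%:C)%C : C)); first exact: cvg_fst.
  exact: continuous_real_complex.
apply: cvgM; first exact: cvg_cst.
apply: (@cvg_comp _ _ _ snd (fun t : R => (t%:C)%C : C)); first exact: cvg_snd.
exact: continuous_real_complex.
Qed.

Lemma normc_ge_Im_abs (z : C) : (`|complex.Im z|%:C)%C <= `|z|.
Proof.
by case: z => a b; rewrite normc_def /= lecR -sqrtr_sqr ler_wsqrtr// lerDr sqr_ge0.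
Qed.

(** The complement of a compact square is a neighbourhood of infinity. *)
Lemma nbhs_infty (M : R) :
  nbhs (None : S2) [set x : S2 | if x is Some z then (M%:C)%C < `|(z : C)| else True].
Proof.
pose K : set C := (fun v : R * R => (v.1 +i* v.2)%C : C) @` (`[- M, M] `*` `[- M, M]).
have cK : compact K.
  apply: continuous_compact; first by apply: continuous_subspaceT; exact: continuous_complex_pair.
  by apply: compact_setX; exact: segment_compact.
exists K.
  split => //; apply: compact_closed => //; exact: norm_hausdorff.
move=> _ [[z nKz <-]|-> //] /=.
rewrite real_ltNge ?normr_real ?complex_real//; apply/negP => zM; apply: nKz.
exists (complex.Re z, complex.Im z); last by case: (z).
have Re1 := le_trans (normc_ge_Re z) zM.
have Im1 := le_trans (normc_ge_Im_abs z) zM.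
move: Re1 Im1; rewrite !lecR !ler_norml => Re1 Im1.
by split => /=; rewrite in_itv.
Qed.

Lemma connected_cplx : connected [set: C].
Proof.
have -> : [set: C] = \bigcup_(z in [set: C]) ((fun t : R => (t%:C)%C * z) @` `[0, 1]).
  apply/seteqP; split => // z _; exists z => //; exists 1; rewrite ?mul1r//.
  by rewrite /= in_itv /= lexx ler01.
apply: bigcup_connected.
  by exists 0 => z _; exists 0; rewrite ?mul0r//= in_itv /= lexx ler01.
move=> z _; apply: connected_continuous_connected; first exact: segment_connected.
apply: continuous_subspaceT => t; apply: cvgM; last exact: cvg_cst.
exact: continuous_real_complex.
Qed.

Lemma near_norm_lt_nat (x : C) : \forall y \near x & n \near \oo, `|y| < n%:R.
Proof.
have [N xN] : exists N : nat, `|x| + 1 < N%:R :> C.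
  have : (0 : C) <= `|x| by [].
  case: (`|x|) => a b; rewrite lecE /= => /andP[/eqP b0 a0].
  exists (Num.bound (a + 1)).
  rewrite -(rmorph_nat (real_complex R)) b0 -(rmorphD (real_complex R) a 1) ltcR.
  by apply: archi_boundP; rewrite addr_ge0.
exists (ball x 1, [set n | (N <= n)%N]) => /=.
  by split; [exact: (nbhsx_ballx x 1 ltr01) | exists N].
move=> -[y n] /= [xy Nn].
apply: lt_le_trans (_ : N%:R <= _); last by rewrite ler_nat.
apply: le_lt_trans xN.
have -> : y = x - (x - y) by ring.
by apply: le_trans (ler_normB _ _) _; rewrite lerD2l ltW.
Qed.

Lemma cplx_not_compact : ~ compact [set: C].
Proof.
move=> /compact_near_coveringP/(_ nat \oo (fun n x => `|x| < n%:R :> C) _)[].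
  by move=> x _; exact: near_norm_lt_nat.
move=> N _ /(_ N (leqnn _) (N%:R) Logic.I) /=.
by rewrite normr_nat ltxx.
Qed.

(** The sphere is the closure of the plane, since the plane is not compact. *)
Lemma sphere_connected : connected [set: S2].
Proof.
have -> : [set: S2] = closure (Some @` [set: C] : set S2).
  apply/seteqP; split => // -[z|] _; first by apply: subset_closure; exists z.
  move=> U [K [cK clK] KU].
  have [z nKz] : exists z, ~ K z.
    apply: contrapT => /forallNP H; apply: cplx_not_compact.
    suff -> : [set: C] = K by [].
    by apply/seteqP; split => // z _; apply: contrapT; apply: H.
  by exists (Some z); split; [exists z | apply: KU; left; exists z].
apply: connected_closure; apply: connected_continuous_connected; first exact: connected_cplx.
by apply: continuous_subspaceT; exact: one_point_compactification_some_continuous.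
Qed.

Lemma continuous_horner_cplx (p : {poly C}) : continuous (horner p).
Proof.
elim/poly_ind: p => [|p c IH] x.
  have -> : horner (0 : {poly C}) = cst 0 by apply/funext => y; rewrite horner0.
  exact: cst_continuous.
have -> : horner (p * 'X + c%:P) = (fun y => p.[y] * y + c).
  by apply/funext => y; rewrite hornerMXaddC.
have H1 := @cplx_contM C (horner p) id x (IH x) cvg_id.
exact: (@cplx_contD C (fun y => p.[y] * y) (fun=> c) x H1 (@cplx_cont_cst C c x)).
Qed.

Lemma near_lt_norm (T : topologicalType) (f g : T -> C) x :
  {for x, continuous f} -> {for x, continuous g} ->
  `|f x| < `|g x| -> \forall y \near x, `|f y| < `|g y|.
Proof.
move=> cf cg fg.
pose e := (`|g x| - `|f x|) / 2.
have e0 : 0 < e by rewrite divr_gt0// subr_gt0.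
near=> y.
have f1 : `|f x - f y| < e by near: y; exact: (@cvgr_dist_lt _ _ _ (nbhs x) _ f (f x) cf e e0).
have g1 : `|g x - g y| < e by near: y; exact: (@cvgr_dist_lt _ _ _ (nbhs x) _ g (g x) cg e e0).
have f2 : `|f y| < `|f x| + e.
  have -> : f y = f x - (f x - f y) by ring.
  by apply: le_lt_trans (ler_normB _ _) _; rewrite ltrD2l.
have g2 : `|g x| - e < `|g y|.
  rewrite ltrBlDr; have {1}-> : g x = g y + (g x - g y) by ring.
  by apply: le_lt_trans (ler_normD _ _) _; rewrite ltrD2l.
apply: lt_trans f2 _; apply: le_lt_trans g2.
rewrite -subr_ge0 /e.
have -> : `|g x| - (`|g x| - `|f x|) / 2 - (`|f x| + (`|g x| - `|f x|) / 2) = 0 by field.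
by [].
Unshelve. all: by end_near. Qed.

End ComplexTopology.

(** * Rational maps are open and closed *)
Section RationalMaps.
Variable R : realType.
Local Notation C := (Cplx R).
Local Notation S2 := (riemann_sphere R).

(** Every root z of f satisfies |y - z| <= |y - x| + |x - z| <= 2 |x - z|, and
    the bound is the product of these inequalities. *)
Lemma growth_away_from_roots (d : nat) (f : {poly C}) (x y e : C) :
  (size f <= d.+1)%N -> (forall z, root f z -> e <= `|x - z|) ->
  `|y - x| <= e -> `|f.[y]| <= 2 ^+ d * `|f.[x]|.
Proof.
move=> sf rf yx.
have [->|f0] := eqVneq f 0; first by rewrite !horner0 normr0 mulr0.
have [r fr] := closed_field_poly_normal f.
have sr : (size r <= d)%N.
  move: sf; rewrite fr size_scale ?lead_coef_eq0//.
  by rewrite size_prod_XsubC.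
have rr z : z \in r -> e <= `|x - z|.
  by move=> zr; apply: rf; rewrite fr rootZ ?lead_coef_eq0// root_prod_XsubC.
rewrite fr !hornerZ !normrM mulrCA ler_wpM2l// !horner_prod !normr_prod.
apply: (@le_trans _ _ (2 ^+ size r * `|\prod_(z <- r) (x - z)|)); last first.
  rewrite normr_prod.
  under [in leRHS]eq_bigr do rewrite hornerXsubC.
  by rewrite ler_wpM2r ?prodr_ge0// ler_weXn2l// ler1n.
rewrite normr_prod; move: rr {fr sr}; elim: r => [|z r IH] rr.
  by rewrite !big_nil mulr1.
rewrite !big_cons /= exprS hornerXsubC mulrACA ler_pM//; first by rewrite prodr_ge0.
  rewrite mulr_natl mulr2n.
  have -> : y - z = (y - x) + (x - z) by ring.
  apply: le_trans (ler_normD _ _) _; rewrite lerD2r.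
  by apply: le_trans yx (rr _ _); rewrite mem_head.
by apply: IH => t tr; apply: rr; rewrite in_cons tr orbT.
Qed.

Lemma nonroot_nearby (f : {poly C}) (x e : C) : f != 0 -> 0 < e ->
  exists2 y, `|y - x| <= e & f.[y] != 0.
Proof.
move=> f0 e0; apply: contrapT => H.
(* More points near x than f can have roots. *)
pose g (k : nat) : C := x + e / k.+1%:R.
have := @max_poly_roots _ f [seq g k | k <- iota 0 (size f)] f0.
rewrite size_map size_iota ltnn => Hr; suff: false by [].
apply: Hr.
  apply/allP => _ /mapP[k _ ->]; apply: contrapT => gk; apply: H; exists (g k); last exact/negP.
  rewrite /g addrC addKr ger0_norm; last by rewrite divr_ge0// ltW.
  by apply: ler_piMr; [exact: ltW | rewrite invf_le1 ?ltr0n// (ler1n C)].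
rewrite map_inj_uniq ?iota_uniq// => j k; rewrite /g => /addrI.
move/(mulfI (lt0r_neq0 e0))/invr_inj/eqP; rewrite eqr_nat => /eqP[].
by [].
Qed.

(** Openness of p/q at a finite point. If p = w q has no solution in the ball
    of radius e around x0, then at a fixed nearby point y that is no root of
    p - w0 q, the value of p - w q is bounded by 2^d times its value at x0. The
    latter tends to 0 as w tends to w0, while the value at y does not. *)
Lemma solution_locally_open (d : nat) (p q : {poly C}) (x0 w0 e : C) :
  (size p <= d.+1)%N -> (size q <= d.+1)%N -> p - w0 *: q != 0 ->
  p.[x0] = w0 * q.[x0] -> 0 < e ->
  \forall w \near w0, exists2 x, `|x - x0| < e & p.[x] = w * q.[x].
Proof.
move=> sp sq f0 px0 e0.
have [y yx fy] := nonroot_nearby x0 f0 e0.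
have : \forall w \near w0, `|2 ^+ d * (p - w *: q).[x0]| < `|(p - w *: q).[y]|.
  have E (t : C) (w : C) : (p - w *: q).[t] = p.[t] - w * q.[t] by rewrite !hornerE.
  have Ec t : continuous (fun w : C => (p - w *: q).[t]).
    under eq_fun do rewrite E.
    move=> w.
    have H1 := @cplx_contM R C id (fun=> q.[t]) w cvg_id (@cplx_cont_cst R C _ w).
    exact: (@cplx_contB R C (fun=> p.[t]) _ w (@cplx_cont_cst R C _ w) H1).
  apply: near_lt_norm.
  - exact: (@cplx_contM R C (fun=> 2 ^+ d) _ w0 (@cplx_cont_cst R C _ w0) (Ec x0 w0)).
  - exact: Ec.
  - by rewrite E px0 subrr mulr0 normr0 normr_gt0.
apply: filterS => w H; apply: contrapT => nx.
have : `|(p - w *: q).[y]| <= 2 ^+ d * `|(p - w *: q).[x0]|.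
  apply: (growth_away_from_roots (e := e)) => //.
    apply: leq_trans (size_polyD _ _) _; rewrite size_polyN geq_max sp /=.
    by apply: leq_trans (size_scale_leq _ _) sq.
  move=> z /rootP; rewrite !hornerE => /eqP; rewrite subr_eq0 => /eqP pz.
  rewrite real_leNgt ?normr_real//; last by rewrite gtr0_real.
  by apply/negP => xz; apply: nx; exists z; rewrite // distrC.
by rewrite normrM normrX normr_nat in H; rewrite real_leNgt ?normr_real ?realM ?normr_real ?realX ?realn// H.
Qed.

Lemma solution_locally_closed (p q : {poly C}) (x0 w0 : C) :
  p.[x0] != w0 * q.[x0] ->
  \forall x \near x0 & w \near w0, p.[x] != w * q.[x].
Proof.
move=> H.
have : \forall v \near (x0, w0), `|(0 : C)| < `|p.[v.1] - v.2 * q.[v.1]|.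
  apply: near_lt_norm.
  - exact: cvg_cst.
  - have c1 (r : {poly C}) : {for (x0, w0), continuous (fun v : C * C => r.[v.1])}.
      apply: (@cvg_comp _ _ _ fst (horner r)); first exact: cvg_fst.
      exact: continuous_horner_cplx.
    have c2 : {for (x0, w0), continuous (@snd C C)} by exact: cvg_snd.
    have H1 := @cplx_contM R (C * C)%type snd _ (x0, w0) c2 (c1 q).
    exact: (@cplx_contB R (C * C)%type _ _ (x0, w0) (c1 p) H1).
  - by rewrite normr0 normr_gt0 subr_eq0.
apply: filterS => -[x w] /=; rewrite normr0 normr_gt0 subr_eq0 //.
Qed.

(** The polynomial p of degree at most d in the chart 1/z at infinity. *)
Definition rev_poly (d : nat) (p : {poly C}) : {poly C} := \poly_(i < d.+1) p`_(d - i).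

Lemma horner_rev_poly (d : nat) (p : {poly C}) (z : C) :
  (size p <= d.+1)%N -> z != 0 -> p.[z] = z ^+ d * (rev_poly d p).[z^-1].
Proof.
move=> sp z0; rewrite (horner_coef_wide _ sp) horner_poly big_distrr /=.
rewrite (reindex_inj rev_ord_inj) /=; apply: eq_bigr => i _.
rewrite subSS mulrCA; congr (_ * _).
by rewrite exprVn expfB_cond // (negbTE z0) /= add0n -ltnS.
Qed.

Lemma rev_poly0 d p : (rev_poly d p).[0] = p`_d.
Proof. by rewrite horner_coef0 coef_poly subn0. Qed.

(** Graph of p/q seen as a map of degree d on the sphere. The denominator is
    cleared, so that no convention on division by 0 enters. *)
Definition maps_to (d : nat) (p q : {poly C}) (x : S2) (w : C) : Prop :=
  match x with Some z => p.[z] = w * q.[z] | None => p`_d = w * q`_d end.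

Lemma maps_to_inv d (p q : {poly C}) (u w : C) :
  (size p <= d.+1)%N -> (size q <= d.+1)%N ->
  (rev_poly d p).[u] = w * (rev_poly d q).[u] <->
  maps_to d p q (if u == 0 then None else Some u^-1) w.
Proof.
move=> sp sq; have [->|u0] := eqVneq u 0; first by rewrite !rev_poly0.
rewrite /= (horner_rev_poly sp) ?invr_eq0// (horner_rev_poly sq) ?invr_eq0// invrK mulrCA.
split => [->//|]; apply: mulfI; rewrite expf_eq0 invr_eq0 (negbTE u0).
by rewrite andbF.
Qed.

Lemma nbhs_infty_inv (O : set S2) : nbhs (None : S2) O ->
  exists2 e : C, 0 < e & forall u, `|u| < e -> O (if u == 0 then None else Some u^-1).
Proof.
case=> K [cK clK] KO.
have [M M0 KM] : exists2 M : C, 0 < M & forall z, K z -> `|z| < M.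
  move/compact_near_coveringP: cK => /(_ nat \oo (fun n x => `|x| < n%:R :> C) _)[].
    move=> x _; exact: near_norm_lt_nat.
  move=> N _ H; exists (N.+1)%:R; first by rewrite ltr0n.
  by move=> z /(H N.+1 (leqnSn N)).
exists M^-1; first by rewrite invr_gt0.
move=> u uM; case: eqVneq => [_|u0]; apply: KO; [by right|left].
exists u^-1 => //= /KM; rewrite normfV.
rewrite invf_plt ?posrE ?normr_gt0// => H.
by have := lt_trans H uM; rewrite ltxx.
Qed.

(** At infinity the statement is transported to 0 by z |-> 1/z, which turns the
    coefficients of p and q around. *)
Lemma maps_to_open d (p q : {poly C}) (x0 : S2) (w0 : C) (O : set S2) :
  (size p <= d.+1)%N -> (size q <= d.+1)%N -> p - w0 *: q != 0 ->
  maps_to d p q x0 w0 -> nbhs x0 O ->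
  \forall w \near w0, exists2 x, O x & maps_to d p q x w.
Proof.
move=> sp sq f0; case: x0 => [x0|] /= pq O0.
  have [e /= e0 eO] := (nbhs_ballP _ _).1 O0.
  apply: filterS (solution_locally_open sp sq f0 pq e0) => w [x xe pqx].
  by exists (Some x) => //; apply: eO; rewrite /ball /= distrC.
have [e e0 eO] := nbhs_infty_inv O0.
have srev (r : {poly C}) : (size (rev_poly d r) <= d.+1)%N by exact: size_poly.
have f1 : rev_poly d p - w0 *: rev_poly d q != 0.
  apply: contra_neq f0 => f1; apply/polyP => i.
  rewrite coefB coefZ coef0.
  have [id|di] := leqP i d; last first.
    by rewrite !nth_default ?mulr0 ?subr0// (leq_trans sq, leq_trans sp).
  move/polyP/(_ (d - i)%N): f1; rewrite coefB coefZ coef0 !coef_poly.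
  by rewrite ltnS leq_subr subKn.
have pq' : (rev_poly d p).[0] = w0 * (rev_poly d q).[0] by rewrite !rev_poly0.
apply: filterS (solution_locally_open (srev p) (srev q) f1 pq' e0) => w [x xe pqx].
exists (if x == 0 then None else Some x^-1).
  by apply: eO; rewrite subr0 in xe.
exact/maps_to_inv.
Qed.

Lemma maps_to_closed d (p q : {poly C}) (x0 : S2) (w0 : C) :
  (size p <= d.+1)%N -> (size q <= d.+1)%N -> ~ maps_to d p q x0 w0 ->
  \forall x \near x0 & w \near w0, ~ maps_to d p q x w.
Proof.
move=> sp sq; case: x0 => [x0|] /= pq.
  have [[A B] [/= Ax Bw] AB] := solution_locally_closed (introN eqP pq).
  exists (Some @` A, B) => /=.
    split => //; change (nbhs x0 (Some @^-1` (Some @` A : set S2))).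
    by apply: filterS Ax; exact: preimage_image.
  by move=> [_ w] /= [[x Ax' <-] Bw'] /=; apply/eqP; exact: (AB (x, w)).
have : (rev_poly d p).[0] != w0 * (rev_poly d q).[0] by rewrite !rev_poly0; exact/eqP.
move=> /solution_locally_closed[[A B] [/= Ax Bw] AB].
have [e /= /ltcR0[r r0 ->] eA] := (@nbhs_ballP _ C 0 A).1 Ax.
exists ([set x : S2 | if x is Some z then ((r^-1)%:C)%C < `|(z : C)| else True], B).
  by split => //; exact: nbhs_infty.
move=> [x w] /= [xr Bw'].
have [u ur xu] : exists2 u : C, ball 0 (r%:C)%C u & x = (if u == 0 then None else Some u^-1).
  case: x xr => [z zr|_]; last by exists 0; rewrite ?eqxx//; rewrite /ball /= subrr normr0 ltcR.
  have z0 : z != 0 by rewrite -normr_gt0; apply: lt_trans zr; rewrite ltcR invr_gt0.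
  exists z^-1; last by rewrite invr_eq0 (negbTE z0) invrK.
  rewrite /ball /= sub0r normrN normfV.
  by rewrite -[ltRHS]invrK ltf_pV2 ?posrE ?normr_gt0// ?invr_gt0 ?ltcR// -fmorphV.
rewrite xu => /(maps_to_inv u w sp sq); apply/eqP.
exact: (AB (u, w) (conj (eA u ur) Bw')).
Qed.

Lemma coprimep_no_common_root (p q : {poly C}) z : coprimep p q -> q.[z] = 0 -> p.[z] != 0.
Proof.
by move=> cpq qz; apply/negP => pz; have := coprimep_root cpq pz; rewrite qz eqxx.
Qed.

End RationalMaps.

(** * Components and relatively clopen parts *)
Section Components.
Variables (X : topologicalType) (G : set X).

Definition rel_clopen (U : set X) :=
  (exists2 O, open O & U = G `&` O) /\ (exists2 F, closed F & U = G `&` F).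

Lemma rel_clopen_sub U : rel_clopen U -> U `<=` G.
Proof. by move=> [[V _ ->] _] x []. Qed.

Lemma rel_clopen_full : rel_clopen G.
Proof.
split; exists setT; rewrite ?setIT//; exact: openT || exact: closedT.
Qed.

Lemma rel_clopenI U B : rel_clopen U ->
  (exists2 O, open O & B = U `&` O) -> (exists2 F, closed F & B = U `&` F) ->
  rel_clopen B /\ rel_clopen (U `\` B).
Proof.
move=> [[V oO UO] [F cF UF]] [V1 oO1 BO] [F1 cF1 BF].
split; split.
- by exists (V `&` V1); [exact: openI | rewrite BO UO setIA].
- by exists (F `&` F1); [exact: closedI | rewrite BF UF setIA].
- exists (V `&` ~` F1); first by apply: openI => //; exact: closed_openC.
  by rewrite BF setDE setCI setIUr setICr set0U setIA -UO.
- exists (F `&` ~` V1); first by apply: closedI => //; exact: open_closedC.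
  by rewrite BO setDE setCI setIUr setICr set0U setIA -UF.
Qed.

(** A component need not be relatively clopen, so the hypothesis does not apply
    to it. However, as long as a clopen part of [G] that contains x is not
    connected, it splits into two nonempty clopen parts. Both contain points of
    the finite set [s], so the part that contains x has fewer points of [s];
    hence the process ends with a connected part, which lies in the component
    of x. *)
Lemma component_meets (s : seq X) :
  (forall U, rel_clopen U -> U !=set0 -> exists2 y, y \in s & U y) ->
  forall x, G x -> exists2 y, y \in s & connected_component G x y.
Proof.
move=> sU x Gx.
suff H (k : nat) (U : set X) : (count (fun y => `[< U y >]) s <= k)%N -> rel_clopen U -> U x ->
    exists2 y, y \in s & connected_component G x y.
  by apply: (H _ G (leqnn _)) => //; exact: rel_clopen_full.
(* Induction on the number of points of s in U. *)
elim: k U => [|k IH] U ck rU Ux.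
  have [|y ys Uy] := sU U rU; first by exists x.
  move: ck; rewrite leqNgt -has_count => /negP[]; apply/hasP; exists y => //.
  exact/asboolP.
have [cU|/existsNP[B /not_implyP[B0 /not_implyP[oB /not_implyP[cB BU]]]]] := pselect (connected U).
  have [|y ys Uy] := sU U rU; first by exists x.
  by exists y => //; apply: (connected_component_max Ux _ cU) => //; exact: rel_clopen_sub.
have [rB rD] := rel_clopenI rU oB cB.
have BsU : B `<=` U by case: oB => O _ ->; exact: subIsetl.
have D0 : (U `\` B) !=set0.
  apply/set0P/eqP => D0; apply: BU; apply/seteqP; split => // z Uz.
  by apply: contrapT => nB; have : (U `\` B) z by []; rewrite D0.
have split_count : (count (fun y => `[< U y >]) s =
    count (fun y => `[< B y >]) s + count (fun y => `[< (U `\` B) y >]) s)%N.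
  rewrite -count_predUI -[LHS]addn0; congr addn; last first.
    apply/esym/eqP; rewrite -leqn0 leqNgt -has_count; apply/hasPn => y _ /=.
    by apply/negP => /andP[/asboolP By /asboolP[]].
  apply: eq_count => y /=; apply/asboolP/orP => [Uy|[|] /asboolP]; last by case.
    by have [By|nB] := pselect (B y); [left|right]; apply/asboolP.
  exact: BsU.
have pos V : rel_clopen V -> V !=set0 -> (0 < count (fun y => `[< V y >]) s)%N.
  move=> rV V0; have [y ys Vy] := sU V rV V0.
  by rewrite -has_count; apply/hasP; exists y => //; apply/asboolP.
have [Bx|nBx] := pselect (B x).
  apply: (IH B) => //; rewrite -ltnS (leq_trans _ ck)// split_count -[X in (X < _)%N]addn0.
  by rewrite ltn_add2l pos.
apply: (IH (U `\` B)) => //; rewrite -ltnS (leq_trans _ ck)// split_count -[X in (X < _)%N]add0n.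
by rewrite ltn_add2r pos.
Qed.

End Components.

Lemma counting_le_seq (R : realType) (T : choiceType) (A : set T) (s : seq T) :
  A `<=` [set` s] -> (@counting T R A <= (size s)%:R%:E)%E.
Proof.
move=> As; have fA : finite_set A by apply: sub_finite_set As _; exact: finite_seq.
rewrite /counting asboolT// lee_fin ler_nat.
apply: uniq_leq_size; first exact: finmap.fset_uniq.
by move=> x; rewrite in_fset_set// inE => /As.
Qed.

Lemma counting_ge_seq (R : realType) (T : choiceType) (A : set T) (s : seq T) :
  uniq s -> [set` s] `<=` A -> ((size s)%:R%:E <= @counting T R A)%E.
Proof.
move=> us sA; rewrite /counting; case: asboolP => [fA|_]; last exact: leey.
rewrite lee_fin ler_nat.
apply: uniq_leq_size => // x xs.
by rewrite in_fset_set// inE; apply: sA.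
Qed.

(** * Components counted by a fibre *)
Section FibreCount.
Variable R : realType.
Local Notation C := (Cplx R).
Local Notation S2 := (riemann_sphere R).

Definition circle_point (t : R) : C := (cos t +i* sin t)%C.

Lemma continuous_circle_point : continuous circle_point.
Proof.
move=> t; apply: (@continuous_comp _ _ _ (fun t : R => (cos t, sin t)) (fun v : R * R => (v.1 +i* v.2)%C : C)).
  have c := @continuous_cos R t; have s := @continuous_sin R t.
  rewrite /prop_for /continuous_at in c s *.
  exact: (cvg_pair c s).
exact: continuous_complex_pair.
Qed.

Lemma normc_eq1 (w : C) : (`|w| == 1) = (complex.Re w ^+ 2 + complex.Im w ^+ 2 == 1).
Proof.
rewrite -[LHS](@eqrXn2 C 2)// expr1n -add_Re2_Im2.
by rewrite (_ : (1 : C) = (1%:C)%C)// eq_complex /= eqxx andbT.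
Qed.

Lemma norm_circle_point t : `|circle_point t| = 1.
Proof. by apply/eqP; rewrite normc_eq1 /= cos2Dsin2. Qed.

Lemma circle_point_surj (w : C) : `|w| = 1 -> exists t, circle_point t = w.
Proof.
move/eqP; rewrite normc_eq1; case: w => a b /= /eqP ab.
have a1 : -1 <= a <= 1.
  rewrite -ler_norml -(@ler_pXn2r _ 2)// ?nnegrE//.
  by rewrite real_normK ?num_real// expr1n -ab lerDl sqr_ge0.
have b2 : b ^+ 2 = 1 - a ^+ 2 by rewrite -ab addrAC subrr add0r.
have [b0|b0] := leP 0 b.
  exists (acos a); rewrite /circle_point acosK ?in_itv//=.
  by rewrite sin_acos// -b2 sqrtr_sqr ger0_norm.
exists (- acos a); rewrite /circle_point cosN sinN acosK ?in_itv//=.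
by rewrite sin_acos// -b2 sqrtr_sqr ltr0_norm// opprK.
Qed.

(** Like [ratfun_val], without the cancellation of common factors. *)
Definition reduced_val (d : nat) (p q : {poly C}) (x : S2) : C :=
  match x with Some z => p.[z] / q.[z] | None => p`_d / q`_d end.

Variables (d : nat) (p q : {poly C}).
Hypothesis cpq : coprimep p q.
Hypothesis dE : d = (maxn (size p) (size q)).-1.
Hypothesis d0 : (0 < d)%N.

Lemma sizep : (size p <= d.+1)%N.
Proof. by rewrite dE (leq_trans (leq_maxl _ (size q)))// leqSpred. Qed.

Lemma sizeq : (size q <= d.+1)%N.
Proof. by rewrite dE (leq_trans (leq_maxr (size p) _))// leqSpred. Qed.

(** The map p/q is not constant: if p = w q with p and q coprime, both have
    degree 0. *)
Lemma pencil_neq0 w : p - w *: q != 0.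
Proof.
rewrite subr_eq0; apply/negP => /eqP pq.
have [w0|w0] := eqVneq w 0.
  move: cpq d0; rewrite dE pq w0 scale0r size_poly0 max0n.
  by rewrite coprime0p => /eqp_size; rewrite size_poly1 => ->.
move: cpq d0; rewrite dE pq size_scale// maxnn coprimepZl// coprimepp => /eqP ->.
by [].
Qed.

(** Coprime p and q do not vanish simultaneously; at infinity, one of them has
    a nonzero coefficient of degree d. *)
Lemma maps_to_pole x w : maps_to d p q x w ->
  match x with Some z => q.[z] | None => q`_d end != 0.
Proof.
case: x => [z|] /= pq; apply/negP => /eqP q0; rewrite q0 mulr0 in pq.
  by have := coprimep_no_common_root cpq q0; rewrite pq eqxx.
have : (size (if (size p <= size q)%N then q else p) = d.+1)%N.
  case: leqP => H; rewrite dE.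
    rewrite (maxn_idPr H) prednK// lt0n; apply/negP => /eqP sq.
    by move: d0; rewrite dE (maxn_idPr H) sq.
  by rewrite (maxn_idPl (ltnW H)) prednK// (leq_ltn_trans _ H).
move=> sr; have : lead_coef (if (size p <= size q)%N then q else p) = 0.
  by rewrite lead_coefE sr /=; case: ifP.
by move/eqP; rewrite lead_coef_eq0 -size_poly_eq0 sr.
Qed.

Lemma maps_toP x w : `|w| = 1 -> reduced_val d p q x = w <-> maps_to d p q x w.
Proof.
move=> w1; have w0 : w != 0 by rewrite -normr_eq0 w1 oner_eq0.
split.
  case: x => [z|] /= E; rewrite -E divfK//; apply/negP => /eqP q0.
    by rewrite q0 invr0 mulr0 in E; rewrite -E eqxx in w0.
  by rewrite q0 invr0 mulr0 in E; rewrite -E eqxx in w0.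
move=> H; have := maps_to_pole H; case: x H => [z|] /= -> q0; by rewrite mulfK.
Qed.

Let G : set S2 := [set x | `|reduced_val d p q x| = 1].

(** The set of real t such that exp(i t) is a value of p/q on [U] is open
    because p/q is open and [U] is relatively open, and closed because the
    graph is closed and [U] is compact. Hence it contains 0, by connectedness
    of the line. *)
Lemma rel_clopen_hits_fibre (U : set S2) : rel_clopen G U -> U !=set0 ->
  exists2 y, U y & maps_to d p q y 1.
Proof.
move=> [[V oV UV] [F cF UF]] [x0 Ux0].
have GE x t : maps_to d p q x (circle_point t) -> G x.
  by move=> /(maps_toP x (norm_circle_point t)); rewrite /G /= => ->; exact: norm_circle_point.
pose W : set R := [set t | exists2 x, U x & maps_to d p q x (circle_point t)].
suff WT : W = setT.
  have : W 0 by rewrite WT.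
  by move=> [x Ux]; rewrite /circle_point cos0 sin0 => H; exists x.
have cT : connected [set: R] by apply/connected_intervalP.
apply: cT.
- have Gx0 : `|reduced_val d p q x0| = 1 by move: Ux0; rewrite UV => -[].
  have [t tE] := circle_point_surj Gx0.
  by exists t; exists x0 => //; apply/maps_toP; rewrite ?norm_circle_point ?tE.
- exists W; last by rewrite setTI.
  rewrite openE => t [x Ux xt].
  have Vx : nbhs x V by move: Ux; rewrite UV => -[_ Vx]; exact: open_nbhs_nbhs.
  have Hw := @continuous_circle_point t _ (maps_to_open sizep sizeq (pencil_neq0 _) xt Vx).
  change (nbhs t W); apply: (@filterS _ (nbhs t) _ _ W _ Hw) => s [y Vy ys].
  by exists y => //; rewrite UV; split => //; exact: GE ys.
- exists W; last by rewrite setTI.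
  rewrite -openC openE => t nWt.
  have cptF : compact F.
    exact: (subclosed_compact cF (@one_point_compactification_compact C)).
  move/compact_near_coveringP: cptF => /(_ R (nbhs t) (fun s x => ~ maps_to d p q x (circle_point s)) _)[].
    move=> x Fx.
    have nx : ~ maps_to d p q x (circle_point t).
      by move=> xt; apply: nWt; exists x => //; rewrite UF; split => //; exact: GE xt.
    have [[A B] [/= Ax Bw] AB] := maps_to_closed sizep sizeq nx.
    exists (A, circle_point @^-1` B); first by split => //; exact: continuous_circle_point.
    by move=> [y s] /= [Ay Bs]; exact: (AB (y, circle_point s)).
  move=> e e0 H; exists e => // s /H Fs [x Ux xs].
  by apply: (Fs x) => //; move: Ux; rewrite UF => -[].
Qed.

(** The finite points of the fibre are the roots of p - q. If infinity is in the
    fibre, the coefficients of degree d cancel, and p - q has one root less. *)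
Lemma fibre_seq : exists2 s : seq S2, (size s <= d)%N & forall y, maps_to d p q y 1 -> y \in s.
Proof.
have f0 : p - q != 0 by have := pencil_neq0 1; rewrite scale1r.
have [r fr] := closed_field_poly_normal (p - q).
have sf : size (p - q)%R = (size r).+1.
  by rewrite fr size_scale ?lead_coef_eq0// size_prod_XsubC.
have sd : (size (p - q)%R <= d.+1)%N.
  by rewrite (leq_trans (size_polyD _ _))// size_polyN geq_max sizep sizeq.
have rr z : maps_to d p q (Some z) 1 -> z \in r.
  rewrite /= mul1r => pz.
  have : root (p - q) z by rewrite /root hornerD hornerN pz subrr.
  by rewrite {1}fr rootZ ?lead_coef_eq0// root_prod_XsubC.
have [pq|pq] := eqVneq (p`_d) (q`_d).
  exists (None :: map Some r).
    rewrite /= size_map -sf; have := sd; rewrite leq_eqVlt => /orP[/eqP sE|//].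
    have := f0; rewrite -lead_coef_eq0 lead_coefE sE /= coefB pq subrr eqxx//.
  move=> [z|] /=; last by rewrite in_cons eqxx.
  by move=> /rr zr; rewrite in_cons; apply/orP; right; apply/mapP; exists z.
exists (map Some r); first by rewrite size_map -ltnS -sf.
move=> [z /rr zr|/=]; first by apply/mapP; exists z.
by rewrite mul1r => E; rewrite E eqxx in pq.
Qed.

Lemma num_components_reduced_le : (num_components R G <= d%:R%:E)%E.
Proof.
have [s sd sE] := fibre_seq.
apply: (@le_trans _ _ (size s)%:R%:E); last by rewrite lee_fin ler_nat.
rewrite -(size_map (connected_component G) s).
apply: counting_le_seq => _ [x Gx <-].
have [y ys xy] : exists2 y, y \in s & connected_component G x y.
  apply: component_meets => // U rU U0.
  by have [y Uy y1] := rel_clopen_hits_fibre rU U0; exists y => //; exact: sE.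
by apply/mapP; exists y => //; exact: same_connected_component.
Qed.

End FibreCount.

(** In degree 0 the fibre argument fails: the rational function is constant. *)
Lemma lemniscate_num_components_le (R : realType) (n : nat) (p q : {poly Cplx R}) :
  (1 <= n)%N -> (size p <= n.+1)%N -> (size q <= n.+1)%N ->
  (num_components R (lemniscate p q) <= n%:R%:E)%E.
Proof.
move=> n1 sp sq.
have empty : lemniscate p q = set0 -> (num_components R (lemniscate p q) <= n%:R%:E)%E.
  move=> ->; rewrite /num_components image_set0.
  by apply: le_trans (counting_le_seq R (s := [::]) _) _; rewrite ?lee_fin ?ler0n.
have not1 (x : Cplx R) : x = 0 -> `|x| <> 1 by move=> ->; rewrite normr0 => /esym/eqP; rewrite oner_eq0.
have [q0|q0] := eqVneq q 0.
  apply: empty; rewrite -subset0 => x; apply: not1; rewrite /ratfun_val q0 div0p.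
  by case: x => [z|]; rewrite ?horner0 ?coef0 invr0 mulr0.
have cpq : coprimep (p %/ gcdp p q) (q %/ gcdp p q) by apply: coprimep_div_gcd; rewrite q0 orbT.
have lev : forall r : {poly Cplx R}, (size r <= n.+1)%N -> (size (r %/ gcdp p q)%R <= n.+1)%N.
  move=> r sr; rewrite size_divp ?gcdp_eq0 ?negb_and ?q0 ?orbT//.
  by rewrite (leq_trans (leq_subr _ _)).
have E : lemniscate p q = [set x | `|reduced_val (maxn (size (p %/ gcdp p q)) (size (q %/ gcdp p q))).-1
  (p %/ gcdp p q) (q %/ gcdp p q) x| = 1] by apply/seteqP; split => -[].
move: (lev _ sp) (lev _ sq) E cpq; set p1 := p %/ _; set q1 := q %/ _.
move=> sp1 sq1 E cpq.
(* The fibre argument settles positive degree; a constant map remains. *)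
have [d0|] := posnP (maxn (size p1) (size q1)).-1; last first.
  move=> d0; rewrite E; apply: le_trans (num_components_reduced_le cpq erefl d0) _.
  by rewrite lee_fin ler_nat -ltnS prednK ?gtn_max ?ltnS ?geq_max ?sp1 ?sq1//; case: (maxn _ _) d0.
have s1 (r : {poly Cplx R}) : (size r <= 1)%N -> r = (r`_0)%:P by exact: size1_polyC.
have H : forall m, m.-1 = 0%N -> (m <= 1)%N by case=> [|[]].
have := H _ d0; rewrite geq_max => /andP[/s1 p1E /s1 q1E].
have vE x : reduced_val 0 p1 q1 x = p1`_0 / q1`_0.
  by case: x => [z|] //=; rewrite {1}p1E {1}q1E !hornerC.
have [v1|v1] := eqVneq `|p1`_0 / q1`_0| 1; last first.
  by apply: empty; rewrite E d0 -subset0 => x /=; rewrite vE => /eqP; rewrite (negbTE v1).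
have -> : lemniscate p q = setT.
  by rewrite E d0; apply/seteqP; split => // x _ /=; rewrite vE.
rewrite /num_components; apply: (@le_trans _ _ 1%:R%:E); last by rewrite lee_fin ler_nat.
apply: (counting_le_seq R (s := [:: setT])) => _ [x _ <-].
by rewrite connected_component_id//= ?mem_head//; exact: sphere_connected.
Qed.

(** * Discs that contain a component *)
Section GoodDiscs.
Variable R : realType.
Local Notation C := (Cplx R).
Local Notation S2 := (riemann_sphere R).

(** Image of the disc |u| < r under the rotation of the sphere [ppoint z0]
    that maps 0 to z0. *)
Definition pdisc (z0 : C) (r : R) : set C := [set z | `|z - z0| < (r%:C)%C * `|1 + z0^* * z|].
Definition pcircle (z0 : C) (r : R) : set C := [set z | `|z - z0| = (r%:C)%C * `|1 + z0^* * z|].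

Definition good_disc (p q : {poly C}) (z0 : C) (r : R) : Prop :=
  `|p.[z0]| < `|q.[z0]| /\ forall z, pcircle z0 r z -> `|q.[z]| < `|p.[z]|.

(** The factor |1 + z0^* z| is at most 2 + |z - z0|, and r |z - z0| is absorbed
    by the left-hand side. *)
Lemma pdisc_close (z0 : C) (r : R) (z : C) : `|z0| <= 1 -> 0 <= r -> r <= 2^-1 ->
  `|z - z0| <= (r%:C)%C * `|1 + z0^* * z| -> `|z - z0| <= (4 * r)%:C%C.
Proof.
move=> z01 r0 r2 zr.
have rC0 : 0 <= (r%:C)%C :> C by rewrite lecR.
have rC2 : (r%:C)%C <= 2^-1 :> C.
  by rewrite (_ : 2^-1 = ((2^-1)%:C)%C :> C) ?lecR// fmorphV rmorph_nat.
have z1 : `|1 + z0^* * z| <= 2 + `|z - z0|.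
  have -> : 1 + z0^* * z = 1 + (z0^* * z0 + z0^* * (z - z0)) by ring.
  apply: le_trans (ler_normD _ _) _; rewrite normr1.
  have -> : 2 + `|z - z0| = 1 + (1 + `|z - z0|) by ring.
  rewrite lerD2l; apply: le_trans (ler_normD _ _) _.
  apply: lerD; rewrite normrM norm_conjC.
    by apply: mulr_ile1.
  by rewrite ler_piMl.
have H := le_trans zr (ler_wpM2l rC0 z1).
have H2 : (r%:C)%C * (2 + `|z - z0|) <= (r%:C)%C * 2 + 2^-1 * `|z - z0|.
  by rewrite mulrDr lerD2l ler_wpM2r.
have := le_trans H H2.
rewrite -lerBlDr => H3.
have E : `|z - z0| - 2^-1 * `|z - z0| = 2^-1 * `|z - z0| by field.
rewrite E in H3.
have : 2 * (2^-1 * `|z - z0|) <= 2 * ((r%:C)%C * 2) by rewrite ler_wpM2l.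
rewrite mulVKf ?pnatr_eq0//.
by rewrite mulrCA -natrM mulrC rmorphM rmorph_nat.
Qed.

(** Stated on the sphere: a disc and its exterior, infinity included, are open,
    so a connected subset of the lemniscate cannot leave a good disc. *)
Lemma pdisc_open z0 r : 0 <= r -> open (Some @` pdisc z0 r : set S2).
Proof.
move=> r0; apply: one_point_compactification_open_some.
rewrite openE => z zD.
have rE w : (r%:C)%C * `|1 + z0^* * w| = `|(r%:C)%C * (1 + z0^* * w)|.
  by rewrite normrM ger0_norm// lecR.
have H : `|('X - z0%:P).[z]| < `|((r%:C)%C *: (1 + z0^* *: 'X)).[z]|.
  by move: zD; rewrite /pdisc /= rE !hornerE.
have := near_lt_norm (@continuous_horner_cplx R _ z) (@continuous_horner_cplx R _ z) H.
change ((\forall y \near z, `|('X - z0%:P).[y]| < `|((r%:C)%C *: (1 + z0^* *: 'X)).[y]|) -> nbhs z (pdisc z0 r)).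
by apply: filterS => w; rewrite /pdisc /= rE !hornerE.
Qed.

Lemma pdisc_exterior_open z0 r : `|z0| <= 1 -> 0 <= r -> r <= 2^-1 ->
  open [set x : S2 | if x is Some z then (r%:C)%C * `|1 + z0^* * z| < `|z - z0| else True].
Proof.
move=> z01 r0 r2; rewrite openE => -[z zD|_].
  have rE w : (r%:C)%C * `|1 + z0^* * w| = `|(r%:C)%C * (1 + z0^* * w)|.
    by rewrite normrM ger0_norm// lecR.
  have H : `|((r%:C)%C *: (1 + z0^* *: 'X)).[z]| < `|('X - z0%:P).[z]|.
    by move: zD; rewrite /= rE !hornerE.
  have := near_lt_norm (@continuous_horner_cplx R _ z) (@continuous_horner_cplx R _ z) H.
  change ((\forall y \near z, `|((r%:C)%C *: (1 + z0^* *: 'X)).[y]| < `|('X - z0%:P).[y]|) ->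
    nbhs z (fun w : C => (r%:C)%C * `|1 + z0^* * w| < `|w - z0|)).
  by apply: filterS => w; rewrite /= rE !hornerE.
apply: filterS (nbhs_infty (4 * r + 1)) => -[z|//] zM.
move: zM => /= zM; rewrite real_ltNge ?normr_real ?realM ?complex_real ?normr_real//.
apply/negP => /(pdisc_close z01 r0 r2) H.
have : `|z| <= ((4 * r + 1)%:C)%C.
  have -> : z = (z - z0) + z0 by ring.
  apply: le_trans (ler_normD _ _) _; rewrite rmorphD lerD//.
by rewrite real_leNgt ?normr_real ?complex_real// zM.
Qed.

(** Rotation of the sphere that maps 0 to z0. *)
Definition ppoint (z0 u : C) : C := (u + z0) / (1 - z0^* * u).

Lemma ppoint_den (z0 u : C) : `|z0| <= 1 -> `|u| <= 2^-1 -> 1 - z0^* * u != 0.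
Proof.
move=> z01 u2; rewrite subr_eq0; apply/negP => /eqP E.
have : `|z0^* * u| <= 2^-1.
  by rewrite normrM norm_conjC; apply: le_trans u2; rewrite ler_piMl.
by rewrite -E normr1 -[X in X <= _]invr1 lef_pV2 ?posrE ?ltr0n// (ler_nat C 2 1).
Qed.

(** With v = 1 + z0^* z, the inverse rotation is u = (z - z0) / v. *)
Lemma ppointE (z0 u : C) : 1 - z0^* * u != 0 ->
  let v := 1 + z0^* * ppoint z0 u in
  (ppoint z0 u - z0 = u * v) * ((1 - z0^* * u) * v = 1 + z0^* * z0).
Proof. by move=> H; split; rewrite /ppoint; field. Qed.

Lemma ppoint_norm (z0 u : C) : `|z0| <= 1 -> `|u| <= 2^-1 ->
  `|ppoint z0 u - z0| = `|u| * `|1 + z0^* * ppoint z0 u| /\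
  0 < `|1 + z0^* * ppoint z0 u|.
Proof.
move=> z01 u2; have H := ppoint_den z01 u2; have [E1 E2] := ppointE H.
split; first by rewrite E1 normrM.
rewrite normr_gt0; apply/negP => /eqP v0; move: E2; rewrite v0 mulr0 => /esym/eqP.
rewrite mulrC -normCK gt_eqF// ltr_wpDr// exprn_ge0//.
Qed.

(** Intermediate value theorem for |p| - |q| along the path t |-> ppoint z0 t
    from the centre to the boundary of the disc. *)
Lemma good_disc_crossing p q z0 r : `|z0| <= 1 -> 0 < r -> r <= 2^-1 ->
  good_disc p q z0 r -> exists2 z, pdisc z0 r z & `|p.[z]| = `|q.[z]|.
Proof.
move=> z01 r0 r2 [pq0 pqr].
have tn t : 0 <= t -> t <= r -> `|(t%:C)%C : C| = (t%:C)%C /\ `|(t%:C)%C : C| <= 2^-1.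
  move=> t0 tr; have tE : `|(t%:C)%C : C| = (t%:C)%C by rewrite ger0_norm// lecR.
  split => //; rewrite tE (_ : 2^-1 = ((2^-1)%:C)%C :> C) ?lecR ?(le_trans tr)//.
  by rewrite fmorphV rmorph_nat.
pose z (t : R) := ppoint z0 (t%:C)%C.
pose den (t : R) : C := 1 - z0^* * (t%:C)%C.
have cden t : {for t, continuous den}.
  apply: (@cplx_contB R R (fun=> 1) (fun t => z0^* * (t%:C)%C)); first exact: cplx_cont_cst.
  apply: (@cplx_contM R R (fun=> z0^*) (fun t => (t%:C)%C)); first exact: cplx_cont_cst.
  exact: continuous_real_complex.
have cz t (f : {poly C}) : den t != 0 -> {for t, continuous (fun t => f.[z t])}.
  move=> dt; apply: (@continuous_comp _ _ _ z (horner f)); last exact: continuous_horner_cplx.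
  apply: (@cplx_contM R R (fun t => (t%:C)%C + z0) (fun t => (den t)^-1)).
    apply: (@cplx_contD R R (fun t => (t%:C)%C) (fun=> z0)); last exact: cplx_cont_cst.
    exact: continuous_real_complex.
  by apply: cvgV => //; exact: cden.
have lt_open (f g : {poly C}) : open [set t | den t != 0 /\ `|f.[z t]| < `|g.[z t]|].
  rewrite openE => t [dt fg].
  have H1 : \forall s \near t, `|(0 : C)| < `|den s|.
    apply: near_lt_norm; [exact: (@cplx_cont_cst R R) | exact: cden |].
    by rewrite normr0 normr_gt0.
  have H2 := near_lt_norm (cz t f dt) (cz t g dt) fg.
  change (nbhs t [set t | den t != 0 /\ `|f.[z t]| < `|g.[z t]|]).
  by apply: filterS2 H1 H2 => s; rewrite normr0 normr_gt0.
apply: contrapT => nz.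
have zD t : 0 <= t -> t < r -> pdisc z0 r (z t).
  move=> t0 tr; have [tE t2] := tn t t0 (ltW tr); have [E1 E2] := ppoint_norm z01 t2.
  by rewrite /pdisc /= E1 tE ltr_pM2r// ltcR.
have dE t : 0 <= t -> t <= r -> den t != 0.
  by move=> t0 tr; have [_ t2] := tn t t0 tr; exact: ppoint_den.
have zr : `|q.[z r]| < `|p.[z r]|.
  have [tE t2] := tn r (ltW r0) (lexx r); have [E1 E2] := ppoint_norm z01 t2.
  by apply: pqr; rewrite /pcircle /= E1 tE.
have z00 : z 0 = z0 by rewrite /z /ppoint add0r mulr0 subr0 divr1.
pose A := [set t | den t != 0 /\ `|p.[z t]| < `|q.[z t]|].
pose B := [set t | den t != 0 /\ `|q.[z t]| < `|p.[z t]|].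
have : `[0, r]%classic `&` A = `[0, r]%classic.
  apply: (@segment_connected R 0 r).
  - exists 0; split; first by rewrite /= in_itv /= lexx ltW.
    by split; [apply: dE; rewrite ?lexx ?ltW | rewrite z00].
  - by exists A => //; exact: lt_open.
  - exists (~` B); first by apply: open_closedC; exact: lt_open.
    apply/seteqP; split => t [tI]; rewrite /= in_itv /= in tI; move/andP: tI => [t0 tr].
      move=> [_ H]; split; first by rewrite /= in_itv /= t0.
      by move=> [_ H2]; have := lt_trans H H2; rewrite ltxx.
    move=> nB; split; first by rewrite /= in_itv /= t0.
    have dt := dE t t0 tr; split => //.
    rewrite real_ltNge ?normr_real//; apply/negP; rewrite le_eqVlt => /orP[/eqP E|H].
      move: tr; rewrite le_eqVlt => /orP[/eqP tr|tr].
        by move: zr; rewrite -tr E ltxx.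
      by apply: nz; exists (z t); [exact: zD | rewrite E].
    by apply: nB.
move/seteqP => [_ /(_ r)] [].
  by rewrite /= in_itv /= lexx ltW.
by move=> _ [_ H]; have := lt_trans H zr; rewrite ltxx.
Qed.

(** Both inequalities of a good disc survive division by the gcd of p and q.
    The disc then contains a point of the lemniscate, whose component cannot
    cross the boundary, as |p/q| = 1 fails there. *)
Lemma good_disc_component (p q : {poly C}) (z0 : C) (r : R) : `|z0| <= 1 -> 0 < r -> r <= 2^-1 ->
  good_disc p q z0 r -> exists2 x, lemniscate p q x &
    connected_component (lemniscate p q) x `<=` Some @` pdisc z0 r.
Proof.
move=> z01 r0 r2 [pq0 pqr].
have q0 : q != 0.
  by apply/negP => /eqP q0; move: pq0; rewrite q0 horner0 normr0 normr_lt0.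
set p1 := p %/ gcdp p q; set q1 := q %/ gcdp p q.
have pE : p = p1 * gcdp p q by rewrite divpK ?dvdp_gcdl.
have qE : q = q1 * gcdp p q by rewrite divpK ?dvdp_gcdr.
have lt1 (f g h : {poly C}) z : `|(f * h).[z]| < `|(g * h).[z]| -> `|f.[z]| < `|g.[z]|.
  rewrite !hornerM !normrM => H.
  have h0 : 0 < `|h.[z]|.
    by rewrite normr_gt0; apply/negP => /eqP h0; move: H; rewrite h0 normr0 !mulr0 ltxx.
  by rewrite ltr_pM2r in H.
have gd : good_disc p1 q1 z0 r.
  split; first by apply: (lt1 _ _ (gcdp p q)); rewrite -pE -qE.
  by move=> z /pqr H; apply: (lt1 _ _ (gcdp p q)); rewrite -pE -qE.
have cpq : coprimep p1 q1 by apply: coprimep_div_gcd; rewrite q0 orbT.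
have [z zD pqz] := good_disc_crossing z01 r0 r2 gd.
have Lz : lemniscate p q (Some z).
  rewrite /lemniscate /= -/p1 -/q1 normf_div pqz divff// normr_eq0.
  apply/negP => /eqP qz; have := coprimep_no_common_root cpq qz.
  by rewrite -normr_eq0 pqz qz normr0 eqxx.
have nC z' : pcircle z0 r z' -> ~ lemniscate p q (Some z').
  move=> /gd.2 H; rewrite /lemniscate /= -/p1 -/q1 normf_div => E.
  have [qz|qz] := eqVneq `|q1.[z']| 0.
    by move/eqP: E; rewrite qz invr0 mulr0 eq_sym oner_eq0.
  by move/divr1_eq: E => E; rewrite E ltxx in H.
exists (Some z) => //.
set K := connected_component _ _.
have Kz : K (Some z) by exact: connected_component_refl.
have Ksub : K `<=` lemniscate p q by exact: connected_component_sub.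
suff <- : K `&` (Some @` pdisc z0 r) = K by exact: subIsetr.
apply: component_connected.
- by exists (Some z); split => //; exists z.
- by exists (Some @` pdisc z0 r) => //; exact: pdisc_open (ltW r0).
- exists (~` [set x : S2 | if x is Some z then (r%:C)%C * `|1 + z0^* * z| < `|z - z0| else True]).
    by apply: open_closedC; exact: pdisc_exterior_open (ltW r0) r2.
  apply/seteqP; split => x [Kx].
    move=> xD; split => //; case: xD => y yD <- /= H.
    by have := lt_trans H yD; rewrite ltxx.
  move=> nx; split => //; move: (Ksub _ Kx) nx; case: x Kx => [y|] Kx Ly nx; last by exfalso; exact: nx.
  exists y => //; rewrite /pdisc /= real_ltNge ?realM ?complex_real ?normr_real//.
  apply/negP; rewrite le_eqVlt => /orP[/eqP E|//].
  by apply: (nC y) => //; rewrite /pcircle /=.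
Qed.

(** A disc of parameter r has points at distance at most 4 r from its centre,
    so centres at distance more than 8 r have disjoint discs. *)
Lemma num_components_ge_good (I : finType) (c : I -> C) (D : {set I}) (r : R) (p q : {poly C}) :
  0 < r -> r <= 2^-1 -> (forall i, `|c i| <= 1) ->
  (forall i j, i != j -> ((8 * r)%:C)%C < `|c i - c j|) ->
  (forall i, i \in D -> good_disc p q (c i) r) ->
  ((#|D|)%:R%:E <= num_components R (lemniscate p q))%E.
Proof.
move=> r0 r2 c1 sep gD.
have /choice[x xP] : forall i, exists x, i \in D -> lemniscate p q x /\
    connected_component (lemniscate p q) x `<=` Some @` pdisc (c i) r.
  move=> i; have [iD|] := boolP (i \in D); last by exists None.
  by have [x Lx Kx] := good_disc_component (c1 i) r0 r2 (gD i iD); exists x.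
have -> : #|D| = size [seq connected_component (lemniscate p q) (x i) | i <- enum D].
  by rewrite size_map cardE.
apply: counting_ge_seq; last first.
  move=> _ /= /mapP[i iD ->]; rewrite mem_enum in iD.
  by exists (x i) => //; exact: (xP i iD).1.
rewrite map_inj_in_uniq ?enum_uniq// => i j; rewrite !mem_enum => iD jD ij.
apply/eqP/negPn/negP => nij.
have [Li Ki] := xP i iD; have [Lj Kj] := xP j jD.
have Kxi := connected_component_refl Li.
have [z zi zx] := Ki _ Kxi.
have [z' zj zx'] : (Some @` pdisc (c j) r) (x i) by apply: Kj; rewrite -ij.
have zz : z' = z by move: zx'; rewrite -zx => -[].
rewrite zz in zj.
have di := pdisc_close (c1 i) (ltW r0) r2 (ltW zi).
have dj := pdisc_close (c1 j) (ltW r0) r2 (ltW zj).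
have : `|c i - c j| <= ((8 * r)%:C)%C.
  have -> : c i - c j = (z - c j) - (z - c i) by ring.
  apply: le_trans (ler_normB _ _) _.
  have -> : ((8 * r)%:C)%C = ((4 * r)%:C)%C + ((4 * r)%:C)%C :> C.
    by rewrite -(rmorphD (real_complex R)); congr (_ %:C)%C; ring.
  exact: lerD.
by move/(lt_le_trans (sep i j nij)); rewrite ltxx.
Qed.

End GoodDiscs.

(** * Gaussian shifts and the Cameron-Martin formula *)
Section Density.
Context d d' (T : measurableType d) (T' : measurableType d') (R : realType).
Variables (mu : {measure set T -> \bar R}) (nu : {measure set T' -> \bar R}).

Import HBNNSimple.
Local Open Scope ereal_scope.

(** A joint form of change of variables (G = 1), integration against a density
    (V the identity) and product formulas for independent variables (c the mean
    of G). Simple functions reduce it to indicators, where it is assumed. *)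
Lemma integral_density (V : T -> T') (G : T -> R) (c : R) (f : T' -> R) :
  measurable_fun setT V -> measurable_fun setT G -> (forall x, (0 <= G x)%R) ->
  measurable_fun setT f -> (forall y, (0 <= f y)%R) ->
  (forall A, measurable A -> \int[mu]_x (G x * \1_A (V x))%:E = c%:E * nu A) ->
  (0 <= c)%R ->
  \int[mu]_x (G x * f (V x))%:E = c%:E * \int[nu]_y (f y)%:E.
Proof.
move=> mV mG G0 mf f0 H c0.
have mEf : measurable_fun setT (EFin \o f) by exact/measurable_EFinP.
pose f_ := nnsfun_approx measurableT mEf.
have f_cvg y : (f_ n y)%:E @[n --> \oo] --> (f y)%:E.
  by apply: cvg_nnsfun_approx => // *; rewrite lee_fin.
have f_nd y : {homo (fun n => f_ n y) : m n / (m <= n)%N >-> (m <= n)%R}.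
  by move=> m n mn; exact/lefP/nd_nnsfun_approx.
have mGf n : measurable_fun setT (fun x => (G x * f_ n (V x))%:E).
  by apply/measurable_EFinP/measurable_funM => //; exact: measurableT_comp.
transitivity (limn (fun n => \int[mu]_x (G x * f_ n (V x))%:E)).
  rewrite -monotone_convergence//.
  - apply: eq_integral => x _; apply/esym/cvg_lim => //.
    rewrite EFinM; under eq_fun do rewrite EFinM.
    by apply: cvgeZl => //; exact: f_cvg.
  - by move=> n x _; rewrite lee_fin mulr_ge0.
  - by move=> x _ m n mn; rewrite lee_fin ler_wpM2l// f_nd.
have E n : \int[mu]_x (G x * f_ n (V x))%:E = c%:E * \int[nu]_y (f_ n y)%:E.
  transitivity (\sum_(k \in range (f_ n)) k%:E * (c%:E * nu (f_ n @^-1` [set k]))).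
    transitivity (\sum_(k \in range (f_ n))
        \int[mu]_x (k%:E * (G x * \1_(f_ n @^-1` [set k]) (V x))%:E)).
      rewrite -ge0_integral_fsum//.
      - apply: eq_integral => x _; rewrite [in LHS]fimfunE.
        rewrite EFinM -fsumEFin// ge0_mule_fsumr.
          by apply: eq_fsbigr => k _; rewrite -!EFinM mulrCA.
        by move=> k; rewrite nnfun_muleindic_ge0.
      - move=> k; apply: measurable_funeM; apply/measurable_EFinP/measurable_funM => //.
        exact: measurableT_comp.
      - move=> k x _; have := nnfun_muleindic_ge0 (f_ n) k (V x).
        rewrite -EFinM -EFinM !lee_fin mulrCA => h; exact: mulr_ge0.
    apply: eq_fsbigr => k /set_mem[y _ <-].
    rewrite ge0_integralZl_EFin ?H//.
    - by move=> x _; rewrite lee_fin mulr_ge0.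
    - by apply/measurable_EFinP/measurable_funM => //; exact: measurableT_comp.
  transitivity (c%:E * \sum_(k \in range (f_ n)) \int[nu]_y (k * \1_(f_ n @^-1` [set k]) y)%:E).
    rewrite ge0_mule_fsumr//; last first.
      by move=> k; apply: integral_ge0 => y _; exact: nnfun_muleindic_ge0.
    apply: eq_fsbigr => k _.
    by rewrite integralZl_indic_nnsfun// integral_indic// setIT muleCA.
  congr (_ * _); rewrite -ge0_integral_fsum//.
  - by apply: eq_integral => y _; rewrite fsumEFin// -fimfunE.
  - by move=> r; exact/measurable_EFinP/measurable_funM.
  - by move=> r x _; rewrite nnfun_muleindic_ge0.
under eq_fun do rewrite E.
have cI : (fun n => \int[nu]_y (f_ n y)%:E) @ \oo --> \int[nu]_y (f y)%:E.
  have -> : \int[nu]_y (f y)%:E = \int[nu]_y limn (fun n => (f_ n y)%:E).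
    by apply: eq_integral => y _; apply/esym/cvg_lim => //; exact: f_cvg.
  apply: cvg_monotone_convergence => //.
  - by move=> n; exact/measurable_EFinP.
  - by move=> n x _; rewrite lee_fin.
  - by move=> x _ m n mn; rewrite lee_fin f_nd.
by apply/cvg_lim => //; apply: cvgeZl.
Qed.

End Density.

Section NormalShift.
Variable R : realType.
Local Notation mu := (@lebesgue_measure R).
Local Open Scope ereal_scope.

Lemma integral_normal_probE (m s : R) (f : R -> R) :
  measurable_fun setT f -> (forall y, (0 <= f y)%R) ->
  \int[normal_prob m s]_y (f y)%:E = \int[mu]_y (normal_pdf m s y * f y)%:E.
Proof.
move=> mf f0; rewrite -[LHS]mul1e; apply/esym.
apply: (@integral_density _ _ _ _ R mu (normal_prob m s) id) => //.
- exact: measurable_normal_pdf.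
- by move=> y; exact: normal_pdf_ge0.
- move=> A mA; rewrite mul1e /normal_prob /= [RHS]integral_mkcond.
  apply: eq_integral => y _; rewrite patchE indicE.
  by case: ifP; rewrite (mulr1, mulr0).
Qed.

Lemma measurable_fun_shift (h : R) : measurable_fun setT (fun y : R => (y + h)%R).
Proof. exact: measurable_funD. Qed.

Lemma lebesgue_measure_shift (h : R) (A : set R) : measurable A ->
  pushforward mu ((fun y => y + h)%R : measurableTypeR R -> measurableTypeR R) A = mu A.
Proof.
move=> mA; apply/esym.
pose sh : measurableTypeR R -> measurableTypeR R := (fun y => y + h)%R.
have msh : measurable_fun setT sh by exact: measurable_fun_shift.
pose mf : {mfun measurableTypeR R >-> measurableTypeR R} :=
  HB.pack sh (isMeasurableFun.Build _ _ _ _ _ msh).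
apply: (@lebesgue_measure_unique R (pushforward mu mf)) => //= _ [[a b]] _ <-.
have -> : pushforward mu sh `]a, b]%classic = mu `](a - h)%R, (b - h)%R]%classic.
  rewrite /pushforward; congr (mu _); apply/seteqP; split => y /=; rewrite !in_itv /= /sh.
    by rewrite ltrBlDr lerBrDr.
  by rewrite ltrBlDr lerBrDr.
by rewrite !lebesgue_measure_itv /= !lte_fin ltrD2r -!EFinB opprB addrA subrK.
Qed.

Lemma integral_shift (h : R) (f : R -> R) :
  measurable_fun setT f -> (forall y, (0 <= f y)%R) ->
  \int[mu]_y (f (y + h)%R)%:E = \int[mu]_y (f y)%:E.
Proof.
move=> mf f0; rewrite -[RHS]mul1e.
rewrite -(@integral_density _ _ _ _ R mu mu (fun y => y + h)%R (cst 1%R) 1%R f)//.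
- by apply: eq_integral => y _; rewrite mul1r.
- exact: measurable_fun_shift.
- move=> A mA; rewrite mul1e.
  under eq_integral do rewrite mul1r.
  transitivity (pushforward mu ((fun y => y + h)%R : measurableTypeR R -> measurableTypeR R) A);
    last exact: lebesgue_measure_shift.
  transitivity (\int[mu]_x (\1_((fun y => y + h)%R @^-1` A) x)%:E); first by [].
  rewrite integral_indic ?setIT//.
  by rewrite -[X in measurable X]setTI; exact: measurable_fun_shift.
Qed.

(** Density of N(-h, s^2) with respect to N(0, s^2). *)
Definition shift_weight (s h y : R) : R := expR (- ((2 * y * h + h ^+ 2) / (2 * s ^+ 2))).

Lemma measurable_shift_weight s h : measurable_fun setT (shift_weight s h).
Proof.
apply: measurableT_comp => //; apply: measurableT_comp => //.
apply: measurable_funM => //; apply: measurable_funD => //.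
by apply: measurable_funM => //; exact: measurable_funM.
Qed.

Lemma normal_prob_shift (s h : R) (A : set R) : s != 0%R -> measurable A ->
  \int[normal_prob 0 s]_y (\1_A (y + h) * shift_weight s h y)%:E = normal_prob 0 s A.
Proof.
move=> s0 mA; rewrite integral_normal_probE; last 2 first.
- apply: measurable_funM; last exact: measurable_shift_weight.
  exact: (measurableT_comp (measurable_indic mA) (measurable_fun_shift h)).
- by move=> y; rewrite mulr_ge0// expR_ge0.
transitivity (\int[mu]_y (normal_pdf 0 s (y + h) * \1_A (y + h))%:E).
  apply: eq_integral => y _; congr (_%:E).
  rewrite mulrCA mulrC; congr (_ * _)%R.
  have E t : normal_pdf 0 s t = (normal_peak s * expR (- t ^+ 2 / (s ^+ 2 *+ 2)))%R.
    by rewrite normal_pdfE //= /normal_fun subr0.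
  rewrite !E /shift_weight -[LHS]mulrA -expRD; congr (_ * expR _)%R.
  have n2 : (2%:R != 0 :> R)%R by [].
  by rewrite -(mulr_natl (s ^+ 2)); field.
rewrite (@integral_shift h (fun y => normal_pdf 0 s y * \1_A y)%R).
- rewrite /normal_prob [RHS]integral_mkcond; apply: eq_integral => y _.
  by rewrite patchE indicE; case: ifP; rewrite (mulr1, mulr0).
- by apply: measurable_funM; [exact: measurable_normal_pdf | exact: measurable_indic].
- by move=> y; rewrite mulr_ge0// normal_pdf_ge0.
Qed.

End NormalShift.

Lemma prod_indic (K : finType) (U T : Type) (A : K -> set T) (y : K -> U -> T) (R : realType) w :
  \prod_k (\1_(A k) (y k w) : R) = \1_[set w | forall k, A k (y k w)] w.
Proof.
have [yA|nyA] := pselect (forall k, A k (y k w)).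
  by rewrite indicE mem_set//= big1// => k _; rewrite indicE mem_set.
rewrite indicE memNset//=; have [k nk] : exists k, ~ A k (y k w) by exact/existsNP.
by rewrite (bigD1 k)//= indicE memNset ?mul0r.
Qed.

Section IndependentNormals.
Context (R : realType) (d : measure_display) (T : measurableType d) (P : probability T R).
Variables (K : finType) (Y : K -> T -> R) (s : K -> R).
Hypothesis mY : forall k, measurable_fun setT (Y k).
Hypothesis s0 : forall k, s k != 0.
Hypothesis rect : forall A : K -> set R, (forall k, measurable (A k)) ->
  P [set w | forall k, A k (Y k w)] = (\prod_k normal_prob 0 (s k) (A k))%E.
Local Open Scope ereal_scope.

Lemma measurable_cylinder (A : K -> set R) : (forall k, measurable (A k)) ->
  measurable [set w | forall k, A k (Y k w)].
Proof.
move=> mA; have -> : [set w | forall k, A k (Y k w)] = \bigcap_(k in setT) (Y k @^-1` A k).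
  by apply/seteqP; split => w /= H k; [move=> _; exact: H | exact: (H k Logic.I)].
apply: fin_bigcap_measurable => [|k _]; first exact: finite_finset.
by rewrite -[X in measurable X]setTI; exact: mY.
Qed.

(** Independence is assumed on rectangles, that is, for indicators. The factors
    are replaced by general functions one at a time: the induction is on the
    list of indices whose factor is not known to be an indicator, and the step
    is [integral_density] with all other factors as weight. *)
Lemma integral_prod_independent (f : K -> R -> R) (m : K -> R) :
  (forall k, measurable_fun setT (f k)) -> (forall k y, 0 <= f k y)%R ->
  (forall k, \int[normal_prob 0 (s k)]_y (f k y)%:E = (m k)%:E) ->
  \int[P]_w (\prod_k f k (Y k w))%:E = (\prod_k m k)%:E.
Proof.
suff H (l : seq K) (f' : K -> R -> R) (m' : K -> R) :
  (forall k, measurable_fun setT (f' k)) -> (forall k y, 0 <= f' k y)%R ->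
  (forall k, \int[normal_prob 0 (s k)]_y (f' k y)%:E = (m' k)%:E) ->
  (forall k, k \notin l -> exists2 A, measurable A & f' k = \1_A) ->
  \int[P]_w (\prod_k f' k (Y k w))%:E = (\prod_k m' k)%:E.
  by move=> mf f0 fm; apply: (H (enum K)) => // k; rewrite mem_enum.
elim: l f' m' => [|j l IH] {}f {}m mf f0 fm fl.
  have /choice[A AP] : forall k, exists A, measurable A /\ f k = \1_A.
    by move=> k; have [A mA fA] := fl k isT; exists A.
  under eq_integral => w _.
    under eq_bigr => k _ do rewrite (AP k).2.
    rewrite prod_indic.
    over.
  rewrite integral_indic//= ?setIT.
    rewrite rect; last by move=> k; exact: (AP k).1.
    rewrite (big_morph EFin EFinM erefl); apply: eq_bigr => k _; rewrite -fm (AP k).2 integral_indic ?setIT//.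
    exact: (AP k).1.
  by apply: measurable_cylinder => k; exact: (AP k).1.
have m0 k : (0 <= m k)%R by rewrite -lee_fin -fm; apply: integral_ge0 => y _; rewrite lee_fin.
pose G w := (\prod_(k | k != j) f k (Y k w))%R.
pose c := (\prod_(k | k != j) m k)%R.
transitivity (\int[P]_w (G w * f j (Y j w))%:E).
  by apply: eq_integral => w _; rewrite (bigD1 j)//= mulrC.
rewrite (@integral_density _ _ _ _ R P (normal_prob 0 (s j)) (Y j) G c (f j))//.
- by rewrite fm -EFinM [in RHS](bigD1 j)//= mulrC.
- exact: mY.
- have -> : G = (fun w => \prod_(k <- [seq k <- index_enum K | k != j]) f k (Y k w))%R.
    by apply/funext => w; rewrite big_filter.
  by apply: measurable_prod => k _; exact: (measurableT_comp (mf k) (mY k)).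
- by move=> w; apply: prodr_ge0.
- exact: mf.
- move=> A mA.
  pose f1 k := if k == j then (\1_A : R -> R) else f k.
  pose m1 k := if k == j then fine (normal_prob 0 (s j) A) else m k.
  have fA : normal_prob 0 (s j) A = (fine (normal_prob 0 (s j) A))%:E.
    by rewrite fineK// fin_num_measure.
  have m1E : (\prod_k m1 k = c * fine (normal_prob 0 (s j) A))%R.
    rewrite (bigD1 j)//= {1}/m1 eqxx mulrC; congr (_ * _)%R.
    by apply: eq_bigr => k /negbTE kj; rewrite /m1 kj.
  have := IH f1 m1; rewrite m1E EFinM -fA => <-.
  + apply: eq_integral => w _; rewrite [in RHS](bigD1 j)//= {1}/f1 eqxx mulrC; congr (_ * _)%:E.
    by apply: eq_bigr => k /negbTE kj; rewrite /f1 kj.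
  + by move=> k; rewrite /f1; case: ifP => // _; exact: measurable_indic.
  + by move=> k y; rewrite /f1; case: ifP.
  + move=> k; rewrite /f1 /m1; case: ifPn => [/eqP ->|_]; last exact: fm.
    by rewrite integral_indic// setIT.
  + move=> k kl; rewrite /f1; case: ifPn => [_|kj]; first by exists A.
    by apply: fl; rewrite inE negb_or kj.
- by apply: prodr_ge0.
Qed.

(** A pi-system that generates the product sigma-algebra on K -> R. *)
Definition rectangles : set (set (K -> R)) :=
  [set B | exists2 A : K -> set R, (forall k, measurable (A k)) & B = [set y | forall k, A k (y k)]].

Local Notation Omega := (g_sigma_algebraType rectangles).

Lemma rectangles_setI_closed : setI_closed rectangles.
Proof.
move=> _ _ [A mA ->] [B mB ->]; exists (fun k => A k `&` B k); first by move=> k; exact: measurableI.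
apply/seteqP; split => y /=; first by move=> [HA HB] k; split.
by move=> H; split => k; have [] := H k.
Qed.

Lemma measurable_coord k : measurable_fun setT (fun y : Omega => y k).
Proof.
move=> _ B mB; rewrite setTI; apply: sub_sigma_algebra.
exists (fun j => if j == k then B else setT); first by move=> j; case: ifP.
apply/seteqP; split => y /=; first by move=> yB j; case: eqP => // ->.
by move=> /(_ k); rewrite eqxx.
Qed.

Lemma measurable_to_Omega (Z : K -> T -> R) : (forall k, measurable_fun setT (Z k)) ->
  measurable_fun setT (fun w => (fun k => Z k w) : Omega).
Proof.
move=> mZ; apply: (@measurability _ _ _ Omega _ _ rectangles) => //.
move=> _ [_ [A mA ->] <-]; rewrite setTI.
have -> : (fun w => (fun k => Z k w) : Omega) @^-1` [set y | forall k, A k (y k)]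
    = \bigcap_(k in setT) (Z k @^-1` A k).
  by apply/seteqP; split => w /= H k; [move=> _; exact: H | exact: (H k Logic.I)].
apply: fin_bigcap_measurable => [|k _]; first exact: finite_finset.
by rewrite -[X in measurable X]setTI; exact: mZ.
Qed.

Section CameronMartin.
Variable h : K -> R.

Definition total_weight (w : T) : R := (\prod_k shift_weight (s k) (h k) (Y k w))%R.

Lemma total_weight_ge0 w : (0 <= total_weight w)%R.
Proof. by apply: prodr_ge0 => k _; exact: expR_ge0. Qed.

Lemma measurable_total_weight : measurable_fun setT total_weight.
Proof.
apply: measurable_prod => k _.
exact: (measurableT_comp (measurable_shift_weight (s k) (h k)) (mY k)).
Qed.

Let nu0 (B : set Omega) : \bar R :=
  \int[P]_(w in (fun w => (fun k => Y k w + h k)%R : Omega) @^-1` B) (total_weight w)%:E.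

Let mYh : measurable_fun setT (fun w => (fun k => Y k w + h k)%R : Omega).
Proof.
by apply: (@measurable_to_Omega (fun k w => Y k w + h k)%R) => k; exact: measurable_funD.
Qed.

Let mYO : measurable_fun setT (fun w => (fun k => Y k w)%R : Omega).
Proof. exact: measurable_to_Omega. Qed.

Let nu00 : nu0 set0 = 0.
Proof. by rewrite /nu0 preimage_set0 integral_set0. Qed.

Let nu0_ge0 B : 0 <= nu0 B.
Proof. by apply: integral_ge0 => w _; rewrite lee_fin total_weight_ge0. Qed.

Let nu0_additive : semi_sigma_additive nu0.
Proof.
move=> F mF tF mUF; rewrite /nu0 preimage_bigcup ge0_integral_bigcup//=.
- by apply: is_cvg_ereal_nneg_natsum_cond => n _ _; exact: nu0_ge0.
- by move=> k; rewrite -[X in measurable X]setTI; exact: mYh.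
- apply: measurable_funTS; apply/measurable_EFinP; exact: measurable_total_weight.
- by move=> w _; rewrite lee_fin total_weight_ge0.
- by move=> i j _ _ [w [Fi Fj]]; apply: tF => //; exists (fun k => Y k w + h k)%R.
Qed.

HB.instance Definition _ := isMeasure.Build _ _ _ nu0 nu00 nu0_ge0 nu0_additive.

(** Under the weighted probability, Y + h has the law that Y has under [P]. Both
    sides are finite measures in [B], and they agree on rectangles by
    [normal_prob_shift] in each coordinate. *)
Theorem cameron_martin (B : set Omega) : measurable B ->
  P ((fun w => (fun k => Y k w) : Omega) @^-1` B) =
  \int[P]_(w in (fun w => (fun k => Y k w + h k)%R : Omega) @^-1` B) (total_weight w)%:E.
Proof.
pose YO : T -> Omega := fun w => (fun k => Y k w).
pose mf : {mfun T >-> Omega} := HB.pack YO (isMeasurableFun.Build _ _ _ _ YO mYO).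
move=> mB; change (pushforward P mf B = nu0 B).
apply: (@measure_unique _ _ Omega rectangles (fun=> setT)) => //.
- exact: rectangles_setI_closed.
- by move=> _; exists (fun=> setT) => //; apply/seteqP; split.
- by rewrite bigcup_const//; exists 0%N.
- move=> _ [A mA ->]; rewrite /pushforward /=.
  transitivity (P [set w | forall k, A k (Y k w)]); first by [].
  rewrite rect// /nu0 integral_mkcond.
  pose f k (y : R) := (\1_(A k) (y + h k) * shift_weight (s k) (h k) y)%R.
  transitivity (\int[P]_w (\prod_k f k (Y k w))%:E); last first.
    apply: eq_integral => w _; rewrite big_split /= (prod_indic A (fun k w => Y k w + h k)%R R w) patchE.
    by rewrite indicE /in_mem /=; case: ifPn => _; rewrite ?mul1r ?mul0r.
  rewrite (@integral_prod_independent f (fun k => fine (normal_prob 0 (s k) (A k))))//.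
  + rewrite (big_morph EFin EFinM erefl); apply: eq_bigr => k _.
    by rewrite fineK//; apply: fin_num_measure; exact: mA.
  + move=> k; apply: measurable_funM; last exact: measurable_shift_weight.
    exact: (measurableT_comp (measurable_indic (mA k)) (measurable_fun_shift (h k))).
  + by move=> k y; rewrite mulr_ge0// expR_ge0.
  + by move=> k; rewrite normal_prob_shift// fineK//; apply: fin_num_measure; exact: mA.
- by move=> _; change (P (YO @^-1` setT) < +oo); rewrite preimage_setT probability_setT ltry.
Qed.

(** A bound for the exponent on [E] bounds the weight from below there. *)
Lemma shifted_event_prob (B : set Omega) (E : set T) (M : R) : measurable B -> measurable E ->
  (forall w, E w -> B (fun k => Y k w + h k)%R) ->
  (forall w, E w -> \sum_k (2 * Y k w * h k + h k ^+ 2) / (2 * s k ^+ 2) <= M)%R ->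
  (expR (- M))%:E * P E <= P ((fun w => (fun k => Y k w) : Omega) @^-1` B).
Proof.
move=> mB mE EB EM; rewrite cameron_martin//.
set Z := (fun w => _) @^-1` B.
have mZ : measurable Z by rewrite -[X in measurable X]setTI; exact: mYh.
apply: (@le_trans _ _ (\int[P]_(w in E) (total_weight w)%:E)); last first.
  apply: ge0_subset_integral => //.
  - by apply: measurable_funTS; apply/measurable_EFinP; exact: measurable_total_weight.
  - by move=> w _; rewrite lee_fin total_weight_ge0.
rewrite -integral_cst//; apply: ge0_le_integral => //.
- by move=> w _; rewrite lee_fin expR_ge0.
- by apply: measurable_funTS; apply/measurable_EFinP; exact: measurable_total_weight.
move=> w Ew; rewrite lee_fin /total_weight /shift_weight -expR_sum ler_expR sumrN lerN2.
exact: EM.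
Qed.

End CameronMartin.

End IndependentNormals.

(** * Second moments *)
Section SecondMoments.
Context (R : realType) (d : measure_display) (T : measurableType d) (P : probability T R).
Local Notation C := (Cplx R).

Definition sqmod (z : C) : R := complex.Re z ^+ 2 + complex.Im z ^+ 2.

Lemma sqmodE z : ((sqmod z)%:C)%C = `|z| ^+ 2.
Proof. exact: add_Re2_Im2. Qed.

Lemma sqmod_ge0 z : 0 <= sqmod z.
Proof. by rewrite addr_ge0// sqr_ge0. Qed.

Lemma Re_mulconj (z w : C) : complex.Re (z * w^*) =
  complex.Re z * complex.Re w + complex.Im z * complex.Im w.
Proof. by case: z w => [a b] [a' b'] /=; ring. Qed.

Lemma Im_mulconj (z w : C) : complex.Im (z * w^*) =
  complex.Im z * complex.Re w - complex.Re z * complex.Im w.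
Proof. by case: z w => [a b] [a' b'] /=; ring. Qed.

Lemma sqmod_Re (z : C) : sqmod z = complex.Re (z * z^*).
Proof. by rewrite Re_mulconj /sqmod !expr2. Qed.

Lemma sqmodM z w : sqmod (z * w) = sqmod z * sqmod w.
Proof. by case: z w => [a b] [a' b']; rewrite /sqmod /=; ring. Qed.

Lemma ReD (z w : C) : complex.Re (z + w) = complex.Re z + complex.Re w.
Proof. by case: z w => [? ?] [? ?]. Qed.
Lemma ImD (z w : C) : complex.Im (z + w) = complex.Im z + complex.Im w.
Proof. by case: z w => [? ?] [? ?]. Qed.
Lemma ReM (z w : C) : complex.Re (z * w) = complex.Re z * complex.Re w - complex.Im z * complex.Im w.
Proof. by case: z w => [? ?] [? ?]. Qed.
Lemma ImM (z w : C) : complex.Im (z * w) = complex.Re z * complex.Im w + complex.Im z * complex.Re w.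
Proof. by case: z w => [? ?] [? ?]. Qed.

Lemma Re_sum (I : Type) (s : seq I) (D : pred I) (F : I -> C) :
  complex.Re (\sum_(i <- s | D i) F i) = \sum_(i <- s | D i) complex.Re (F i).
Proof. exact: (big_morph (@complex.Re R) ReD erefl). Qed.
Lemma Im_sum (I : Type) (s : seq I) (D : pred I) (F : I -> C) :
  complex.Im (\sum_(i <- s | D i) F i) = \sum_(i <- s | D i) complex.Im (F i).
Proof. exact: (big_morph (@complex.Im R) ImD erefl). Qed.

Variables (I : finType) (a : I -> T -> C) (v : I -> R).
Hypothesis mRe : forall i, measurable_fun setT (fun w => complex.Re (a i w)).
Hypothesis mIm : forall i, measurable_fun setT (fun w => complex.Im (a i w)).
Hypothesis v0 : forall i, 0 < v i.
Hypothesis cov : forall i j, complex_expectation P (fun w => a i w * (a j w)^*)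
  = if i == j then ((v i)%:C)%C else 0.

Lemma measurable_sqmod i : measurable_fun setT (fun w => sqmod (a i w)).
Proof. by apply: measurable_funD; exact: measurable_funX. Qed.

(** The hypothesis concerns the real number [fine] of an integral, which is 0
    for an infinite integral; v_i > 0 rules this out. All integrability below
    derives from this. *)
Lemma integral_sqmod i : (\int[P]_w (sqmod (a i w))%:E = (v i)%:E)%E.
Proof.
have := cov i i; rewrite eqxx /complex_expectation => /eqP; rewrite eq_complex /= => /andP[/eqP + _].
rewrite unlock; under eq_integral do rewrite -sqmod_Re.
have : (0 <= \int[P]_w (sqmod (a i w))%:E)%E.
  by apply: integral_ge0 => w _; rewrite lee_fin sqmod_ge0.
case: (\int[P]_w (sqmod (a i w))%:E)%E => //= [r _ -> //|_ E].
by have := v0 i; rewrite -E ltxx.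
Qed.

Lemma integrable_sqmod i : P.-integrable setT (EFin \o (fun w => sqmod (a i w))).
Proof.
apply/integrableP; split; first by apply/measurable_EFinP; exact: measurable_sqmod.
under eq_integral do rewrite /= ger0_norm ?sqmod_ge0//.
by rewrite integral_sqmod ltry.
Qed.

Lemma integrable_dominated (X : T -> R) i j : measurable_fun setT X ->
  (forall w, `|X w| <= sqmod (a i w) + sqmod (a j w)) ->
  P.-integrable setT (EFin \o X).
Proof.
move=> mX Xb; apply: (le_integrable measurableT (g := EFin \o (fun w => sqmod (a i w) + sqmod (a j w)))).
- exact/measurable_EFinP.
- move=> w _; rewrite /= lee_fin [leRHS]ger0_norm; first exact: Xb.
  by rewrite addr_ge0// sqmod_ge0.
- exact: (integrableD measurableT (integrable_sqmod i) (integrable_sqmod j)).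
Qed.

Lemma prod_bound (x y x' y' : R) : `|x * x' + y * y'| <= (x ^+ 2 + y ^+ 2) + (x' ^+ 2 + y' ^+ 2).
Proof.
have h1 := sqr_ge0 (x - x'); have h2 := sqr_ge0 (y - y').
have h3 := sqr_ge0 (x + x'); have h4 := sqr_ge0 (y + y').
by rewrite ler_norml; apply/andP; split; nra.
Qed.

Lemma integrable_Re i j : P.-integrable setT (EFin \o (fun w => complex.Re (a i w * (a j w)^*))).
Proof.
apply: (integrable_dominated (i := i) (j := j)).
  under eq_fun do rewrite Re_mulconj.
  by apply: measurable_funD; exact: measurable_funM.
by move=> w; rewrite Re_mulconj; exact: prod_bound.
Qed.

Lemma integrable_Im i j : P.-integrable setT (EFin \o (fun w => complex.Im (a i w * (a j w)^*))).
Proof.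
apply: (integrable_dominated (i := i) (j := j)).
  under eq_fun do rewrite Im_mulconj.
  by apply: measurable_funB; exact: measurable_funM.
move=> w; rewrite Im_mulconj -mulrN.
apply: le_trans (prod_bound _ _ _ _) _.
by rewrite le_eqVlt; apply/orP; left; apply/eqP; rewrite /sqmod; ring.
Qed.

Lemma integral_Re i j : (\int[P]_w (complex.Re (a i w * (a j w)^*))%:E = (if i == j then v i else 0)%:E)%E.
Proof.
have := cov i j; rewrite /complex_expectation unlock => /(congr1 (@complex.Re R)) /=.
have -> : complex.Re (if i == j then ((v i)%:C)%C else 0 : C) = (if i == j then v i else 0) by case: ifP.
move=> <-; rewrite fineK//.
exact: (integrable_fin_num measurableT (integrable_Re i j)).
Qed.

Lemma integral_Im i j : (\int[P]_w (complex.Im (a i w * (a j w)^*))%:E = 0)%E.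
Proof.
have := cov i j; rewrite /complex_expectation unlock => /(congr1 (@complex.Im R)) /=.
have -> : complex.Im (if i == j then ((v i)%:C)%C else 0 : C) = 0 by case: ifP.
have := integrable_fin_num measurableT (integrable_Im i j).
by rewrite /comp /=; case: (integral _ _ _) => //= r _ ->.
Qed.

Lemma integral_sqmod_sum (c : I -> C) :
  (\int[P]_w (sqmod (\sum_i c i * a i w))%:E = (\sum_i sqmod (c i) * v i)%:E)%E.
Proof.
pose g (u : I * I) w : R := complex.Re (c u.1 * (c u.2)^*) * complex.Re (a u.1 w * (a u.2 w)^*)
   - complex.Im (c u.1 * (c u.2)^*) * complex.Im (a u.1 w * (a u.2 w)^*).
have gE w : sqmod (\sum_i c i * a i w) = \sum_u g u w.
  rewrite sqmod_Re rmorph_sum big_distrlr /= pair_big /= Re_sum.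
  apply: eq_bigr => u _; rewrite rmorphM /g -ReM; congr complex.Re.
  by ring.
have ig u : P.-integrable setT (fun w => (g u w)%:E).
  have -> : (fun w => (g u w)%:E) = (fun w =>
      ((complex.Re (c u.1 * (c u.2)^*))%:E * (complex.Re (a u.1 w * (a u.2 w)^*))%:E
      - (complex.Im (c u.1 * (c u.2)^*))%:E * (complex.Im (a u.1 w * (a u.2 w)^*))%:E)%E) by [].
  by apply: integrableB => //; apply: integrableZl => //; [exact: integrable_Re | exact: integrable_Im].
have Ig u : (\int[P]_w (g u w)%:E = (complex.Re (c u.1 * (c u.2)^*) * (if u.1 == u.2 then v u.1 else 0))%:E)%E.
  rewrite /g; under eq_integral do rewrite EFinB !EFinM.
  rewrite integralB//; last 2 first.
  - by apply: integrableZl => //; exact: integrable_Re.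
  - by apply: integrableZl => //; exact: integrable_Im.
  rewrite !integralZl ?integral_Re ?integral_Im ?mule0 ?sube0//.
  - exact: integrable_Im.
  - exact: integrable_Re.
under eq_integral do rewrite gE -sumEFin.
rewrite integral_sum//.
under eq_bigr do rewrite Ig.
rewrite sumEFin; congr (_%:E).
rewrite -(pair_bigA _ (fun i j => complex.Re (c i * (c j)^*) * (if i == j then v i else 0))) /=.
apply: eq_bigr => i _; rewrite (bigD1 i)//= eqxx big1 ?addr0 -?sqmod_Re//.
by move=> j ji; rewrite eq_sym (negbTE ji) mulr0.
Qed.

Lemma measurable_sqmod_sum (c : I -> C) : measurable_fun setT (fun w => sqmod (\sum_i c i * a i w)).
Proof.
rewrite /sqmod; under eq_fun do rewrite Re_sum Im_sum.
apply: measurable_funD; apply: measurable_funX; apply: measurable_sum => i.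
  under eq_fun do rewrite ReM.
  by apply: measurable_funB; apply: measurable_funM.
under eq_fun do rewrite ImM.
by apply: measurable_funD; apply: measurable_funM.
Qed.

End SecondMoments.

Lemma markov_ge0 (R : realType) (d : measure_display) (T : measurableType d) (P : probability T R)
  (X : T -> R) (m t : R) : measurable_fun setT X -> (forall w, 0 <= X w) ->
  (\int[P]_w (X w)%:E = m%:E)%E -> 0 < t ->
  (P [set w | (t < X w)%R] <= (m / t)%:E)%E /\ measurable [set w | (t < X w)%R].
Proof.
move=> mX X0 Xm t0.
have mS : measurable [set w | (t < X w)%R].
  have -> : [set w | (t < X w)%R] = X @^-1` `]t, +oo[%classic.
    by apply/seteqP; split => w /=; rewrite in_itv /= andbT.
  by rewrite -[X in measurable X]setTI; exact: mX.
split => //; rewrite -(@lee_pmul2l _ t%:E)//.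
rewrite -EFinM mulrCA mulfV ?gt_eqF// mulr1 -Xm -integral_cst//.
apply: (@le_trans _ _ (\int[P]_(w in [set w | (t < X w)%R]) (X w)%:E)%E).
  apply: ge0_le_integral => //.
  - by move=> w _; rewrite lee_fin ltW.
  - by apply: measurable_funTS; exact/measurable_EFinP.
  - by move=> w /ltW; rewrite lee_fin.
by apply: ge0_subset_integral => //; [exact/measurable_EFinP | move=> w _; rewrite lee_fin].
Qed.

Section NormalVariance.
Variable R : realType.
Local Open Scope ereal_scope.

(** The sharp constant is 1. The constant 6 comes from comparing the density of
    N(0, s^2) with that of N(0, (2s)^2): with q = y^2/s^2, the quotient is
    2 exp(- 3 q / 8), and q exp(- 3 q / 8) <= 8/3. *)
Lemma normal_second_moment_le (s : R) : (0 < s)%R ->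
  \int[normal_prob 0 s]_y (y ^+ 2)%:E <= (6 * s ^+ 2)%:E.
Proof.
move=> s0; have sn0 : s != 0%R by rewrite gt_eqF.
have s2 : (2%:R * s != 0)%R by rewrite mulf_neq0// pnatr_eq0.
rewrite integral_normal_probE//; last by move=> y; exact: sqr_ge0.
have peak : normal_peak s = (2%:R * normal_peak (2%:R * s))%R.
  rewrite /normal_peak.
  have -> : ((2%:R * s) ^+ 2 * pi *+ 2 = 2%:R ^+ 2 * (s ^+ 2 * pi *+ 2))%R.
    by rewrite exprMn mulrnAr mulrA.
  rewrite [in RHS]sqrtrM ?exprn_ge0// sqrtr_sqr ger0_norm//.
  by rewrite invfM mulrA mulfV ?pnatr_eq0// mul1r.
have E u t : u != 0%R -> normal_pdf 0 u t = (normal_peak u * expR (- t ^+ 2 / (u ^+ 2 *+ 2)))%R.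
  by move=> u0; rewrite normal_pdfE //= /normal_fun subr0.
have -> : (6 * s ^+ 2)%:E = (6 * s ^+ 2)%:E * \int[lebesgue_measure]_y (normal_pdf 0 (2%:R * s) y)%:E.
  by rewrite integral_normal_pdf mule1.
rewrite -ge0_integralZl_EFin//; last 3 first.
- by move=> y _; rewrite lee_fin normal_pdf_ge0.
- by apply/measurable_EFinP; exact: measurable_normal_pdf.
- by rewrite mulr_ge0// sqr_ge0.
apply: ge0_le_integral => //.
- by move=> y _; rewrite lee_fin mulr_ge0 ?normal_pdf_ge0 ?sqr_ge0.
- apply/measurable_EFinP/measurable_funM; first exact: measurable_normal_pdf.
  exact: measurable_funX.
- by apply: measurable_funeM; apply/measurable_EFinP; exact: measurable_normal_pdf.
move=> y _; rewrite -EFinM lee_fin !E// peak.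
pose q := (y ^+ 2 / s ^+ 2)%R.
have q0 : (0 <= q)%R by rewrite divr_ge0 ?sqr_ge0.
have yq : (y ^+ 2 = q * s ^+ 2)%R by rewrite /q divfK// expf_neq0.
have -> : (- y ^+ 2 / (s ^+ 2 *+ 2) = - (3 / 8 * q) + - y ^+ 2 / ((2%:R * s) ^+ 2 *+ 2))%R.
  by rewrite /q -(mulr_natl (s ^+ 2) 2) -(mulr_natl ((2%:R * s) ^+ 2) 2); field.
rewrite expRD.
set e2 := expR (- y ^+ 2 / _); set e1 := expR _; set p := normal_peak _.
have p0 : (0 <= p)%R by exact: normal_peak_ge0.
have e20 : (0 <= e2)%R by exact: expR_ge0.
have key : (q * e1 <= 8 / 3)%R.
  rewrite /e1 expRN ler_pdivrMr ?expR_gt0//.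
  have := expR_ge1Dx (3 / 8 * q)%R; lra.
rewrite yq.
have -> : (2 * p * (e1 * e2) * (q * s ^+ 2) = (q * e1) * (2 * s ^+ 2 * (p * e2)))%R by ring.
have w0 : (0 <= s ^+ 2 * (p * e2))%R by rewrite mulr_ge0 ?sqr_ge0// mulr_ge0.
have : (q * e1 * (2 * s ^+ 2 * (p * e2)) <= 8 / 3 * (2 * s ^+ 2 * (p * e2)))%R.
  by rewrite ler_wpM2r// -mulrA mulr_ge0.
by move/le_trans; apply; lra.
Qed.

End NormalVariance.

Lemma gaussian_variance_le (R : realType) (d : measure_display) (T : measurableType d) (P : probability T R)
  (Y : T -> R) (s : R) : measurable_fun setT Y -> 0 < s ->
  (forall A, measurable A -> P (Y @^-1` A) = normal_prob 0 s A) ->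
  (\int[P]_w (Y w ^+ 2)%:E <= (6 * s ^+ 2)%:E)%E.
Proof.
move=> mY s0 law.
apply: le_trans (normal_second_moment_le s0).
rewrite -[leRHS]mul1e -(@integral_density _ _ _ _ R P (normal_prob 0 s) Y (cst 1) 1 (fun y => y ^+ 2))//.
- rewrite le_eqVlt; apply/orP; left; apply/eqP.
  by apply: eq_integral => w _; rewrite mul1r.
- by move=> y; exact: sqr_ge0.
- move=> A mA; rewrite mul1e; transitivity (P (Y @^-1` A)); last exact: law.
  under eq_integral do rewrite mul1r.
  transitivity (\int[P]_w (\1_(Y @^-1` A) w)%:E)%E; first by [].
  rewrite integral_indic ?setIT//.
  by rewrite -[X in measurable X]setTI; exact: mY.
Qed.

(** * Polynomials rotated to a point of the sphere *)
Section LocalExpansion.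
Variable R : realType.
Local Notation C := (Cplx R).

(** Real-valued modulus: the norm of C takes its values in C. *)
Definition cabs (z : C) : R := complex.Re `|z|.

Lemma cabsE (z : C) : ((cabs z)%:C)%C = `|z|.
Proof. by rewrite /cabs normc_def. Qed.

Lemma cabs_ge0 z : 0 <= cabs z.
Proof. by rewrite -(@lecR R) cabsE; exact: normr_ge0. Qed.

Lemma cabs_sq z : cabs z ^+ 2 = sqmod z.
Proof. by apply: (@complexI R); rewrite rmorphXn /= cabsE sqmodE. Qed.

Lemma cabsM z w : cabs (z * w) = cabs z * cabs w.
Proof. by apply: (@complexI R); rewrite rmorphM /= !cabsE normrM. Qed.

Lemma cabsX z k : cabs (z ^+ k) = cabs z ^+ k.
Proof. by apply: (@complexI R); rewrite rmorphXn /= !cabsE normrX. Qed.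

Lemma cabsD z w : cabs (z + w) <= cabs z + cabs w.
Proof. by rewrite -(@lecR R) rmorphD /= !cabsE ler_normD. Qed.

Lemma cabsN z : cabs (- z) = cabs z.
Proof. by apply: (@complexI R); rewrite !cabsE normrN. Qed.

Lemma cabs_real (r : R) : 0 <= r -> cabs (r%:C)%C = r.
Proof. by move=> r0; apply: (@complexI R); rewrite cabsE ger0_norm// lecR. Qed.

Lemma cabs_sum (I : Type) (s : seq I) (D : pred I) (F : I -> C) :
  cabs (\sum_(i <- s | D i) F i) <= \sum_(i <- s | D i) cabs (F i).
Proof.
by rewrite -(@lecR R) cabsE rmorph_sum /=; under [leRHS]eq_bigr do rewrite cabsE; exact: ler_norm_sum.
Qed.

Lemma sqmodX (z : C) k : sqmod (z ^+ k) = sqmod z ^+ k.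
Proof. by rewrite -!cabs_sq cabsX exprAC. Qed.

Lemma sqmod_conj (z : C) : sqmod (z^*) = sqmod z.
Proof. by case: z => x y; rewrite /sqmod /= sqrrN. Qed.

Lemma sqmod_real (r : R) : sqmod (r%:C)%C = r ^+ 2.
Proof. by rewrite /sqmod /= expr0n addr0. Qed.

Lemma sqmodB_le (z w : C) : sqmod (z - w) <= 2 * sqmod z + 2 * sqmod w.
Proof.
case: z w => x y [x' y']; rewrite /sqmod /=.
have h1 := sqr_ge0 (x + x'); have h2 := sqr_ge0 (y + y').
by rewrite -subr_ge0; nra.
Qed.

Variables (n : nat) (z0 : C).

(** The monomial z^k in the rotated coordinate z = ppoint z0 u, multiplied by
    (1 - z0^* u)^n to clear denominators. *)
Definition local_basis (k : nat) : {poly C} :=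
  ('X + z0%:P) ^+ k * (1 - z0^*%:P * 'X) ^+ (n - k).

Definition local_poly (c : 'I_n.+1 -> C) : {poly C} := \sum_k c k *: local_basis k.

Lemma horner_local_basis k u : (local_basis k).[u] = (u + z0) ^+ k * (1 - z0^* * u) ^+ (n - k).
Proof. by rewrite /local_basis !hornerE. Qed.

Lemma size_local_basis (k : 'I_n.+1) : (size (local_basis k) <= n.+1)%N.
Proof.
apply: leq_trans (size_polyMleq _ _) _.
have s1 : (size ('X + z0%:P : {poly C})%R <= 2)%N.
  by rewrite size_XaddC.
have s2 : (size (1 - z0^*%:P * 'X : {poly C})%R <= 2)%N.
  apply: leq_trans (size_polyD _ _) _; rewrite size_poly1 size_polyN geq_max /=.
  by rewrite mul_polyC (leq_trans (size_scale_leq _ _))// size_polyX.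
have e1 : (size (('X + z0%:P) ^+ k)%R <= k.+1)%N.
  apply: leq_trans (size_poly_exp_leq _ _) _; rewrite ltnS.
  by rewrite -[leqRHS]mul1n leq_mul2r -subn1 leq_subLR s1 orbT.
have e2 : (size ((1 - z0^*%:P * 'X) ^+ (n - k))%R <= (n - k).+1)%N.
  apply: leq_trans (size_poly_exp_leq _ _) _; rewrite ltnS.
  by rewrite -[leqRHS]mul1n leq_mul2r -subn1 leq_subLR s2 orbT.
apply: (@leq_trans (k.+1 + (n - k).+1).-1).
  by rewrite -!subn1 leq_sub2r// leq_add.
by rewrite addnS /= addSn subnKC// -ltnS.
Qed.

Lemma size_local_poly c : (size (local_poly c) <= n.+1)%N.
Proof.
apply: (big_ind (fun p : {poly C} => (size p <= n.+1)%N)).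
- by rewrite size_poly0.
- by move=> p q sp sq; rewrite (leq_trans (size_polyD _ _))// geq_max sp.
- by move=> k _; rewrite (leq_trans (size_scale_leq _ _))// size_local_basis.
Qed.

Lemma coef_local_poly c j : (local_poly c)`_j = \sum_(k < n.+1) (local_basis k)`_j * c k.
Proof. by rewrite coef_sum; apply: eq_bigr => k _; rewrite coefZ mulrC. Qed.

Lemma local_polyD c c' : local_poly (fun k => c k + c' k) = local_poly c + local_poly c'.
Proof. by rewrite -big_split; apply: eq_bigr => k _; rewrite scalerDl. Qed.

Definition coef_poly_of (c : 'I_n.+1 -> C) : {poly C} := \sum_k c k *: 'X^k.

(** The factor does not vanish, so moduli of p and q at a point of the disc can
    be compared in the local coordinate. *)
Lemma horner_local_poly c u : 1 - z0^* * u != 0 ->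
  (local_poly c).[u] = (1 - z0^* * u) ^+ n * (coef_poly_of c).[ppoint z0 u].
Proof.
move=> d0; rewrite !horner_sum big_distrr; apply: eq_bigr => k _.
rewrite !hornerZ horner_local_basis hornerXn /ppoint expr_div_n [RHS]mulrCA; congr (_ * _).
have -> : (1 - z0^* * u) ^+ n = (1 - z0^* * u) ^+ (n - k) * (1 - z0^* * u) ^+ k.
  by rewrite -exprD subnK// -ltnS.
by field; rewrite expf_neq0.
Qed.

(** Coefficients of (al + be X)^n. *)
Definition binom_coefs (al be : C) (k : 'I_n.+1) : C := 'C(n, k)%:R * (al ^+ (n - k) * be ^+ k).

Lemma local_binom al be u : (local_poly (binom_coefs al be)).[u] =
  (al * (1 - z0^* * u) + be * (u + z0)) ^+ n.
Proof.
rewrite horner_sum exprDn; apply: eq_bigr => k _.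
rewrite hornerZ horner_local_basis /binom_coefs !exprMn -mulr_natl; ring.
Qed.

Lemma sum_binom_coefs al be :
  \sum_k sqmod (binom_coefs al be k) / 'C(n, k)%:R = (sqmod al + sqmod be) ^+ n.
Proof.
rewrite exprDn; apply: eq_bigr => k _.
have C0 : 'C(n, k)%:R != 0 :> R by rewrite pnatr_eq0 -lt0n bin_gt0 -ltnS.
rewrite /binom_coefs -(rmorph_nat (real_complex R)) !sqmodM !sqmodX sqmod_real -mulr_natl.
by field.
Qed.

(** Rotations of the sphere act unitarily on polynomials of degree n, for the
    inner product in which X^k has squared norm 1/C(n,k). With A_k the local
    basis, sum_k C(n,k) A_k(X) A_k^*(Y) is by the binomial formula the n-th
    power of (1 + |z0|^2)(1 + X Y); the diagonal coefficients give the claim. *)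
Lemma sum_local_basis (j : 'I_n.+1) :
  \sum_(k < n.+1) sqmod (local_basis k)`_j * 'C(n, k)%:R = (1 + sqmod z0) ^+ n * 'C(n, j)%:R.
Proof.
pose B (k : nat) : {poly C} := map_poly Num.conj (local_basis k).
have BE k : B k = ('X + z0^*%:P) ^+ k * (1 - z0%:P * 'X) ^+ (n - k).
  rewrite /B /local_basis rmorphM !rmorphXn /= rmorphD rmorphB rmorphM /= !map_polyC map_polyX ?rmorph1 /=.
  by rewrite (conjCK z0) (conjC1 C) polyC1.
pose F : {poly {poly C}} := \sum_(k < n.+1) ((local_basis k)%:P * (B k)^:P) *+ 'C(n, k).
pose x : {poly {poly C}} := (1 - z0^*%:P * 'X)%:P * (1 - z0%:P%:P * 'X).
pose y : {poly {poly C}} := ('X + z0%:P)%:P * ('X + z0^*%:P%:P).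
have FE : F = (x + y) ^+ n.
  rewrite exprDn; apply: eq_bigr => k _; congr (_ *+ _).
  rewrite BE /x /y /local_basis polyCM !rmorphXn /= !rmorphM !rmorphXn /= rmorphD rmorphB rmorphM /=.
  have e1 : ('X + z0^*%:P)^:P = 'X + z0^*%:P%:P :> {poly {poly C}}.
    by rewrite rmorphD /= map_polyX map_polyC.
  have e2 : (1 - z0%:P * 'X)^:P = 1 - z0%:P%:P * 'X :> {poly {poly C}}.
    by rewrite rmorphB rmorphM /= map_polyX !map_polyC /= !polyC1.
  by rewrite e1 e2 !exprMn; ring.
have xy : x + y = (1 + z0^* * z0)%:P%:P * (1 + 'X%:P * 'X).
  by rewrite /x /y !(polyCD, polyCN, polyCM, polyC1); ring.
have Fjj : F`_j`_j = \sum_(k < n.+1) ((sqmod (local_basis k)`_j * 'C(n, k)%:R)%:C)%C.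
  rewrite coef_sum coef_sum; apply: eq_bigr => k _.
  rewrite !coefMn coefCM coef_map coefMC coef_map /= -normCK -sqmodE.
  by rewrite rmorphM rmorph_nat mulr_natr.
have Gjj : F`_j`_j = (((1 + sqmod z0) ^+ n * 'C(n, j)%:R)%:C)%C.
  have eX (i : nat) : ('X%:P * 'X) ^+ i = ('X^i)%:P * 'X^i :> {poly {poly C}}.
    by rewrite exprMn rmorphXn.
  have eN (c : C) : c%:P%:P ^+ n = (c ^+ n)%:P%:P :> {poly {poly C}} by rewrite !rmorphXn.
  have G (c : C) : ((c%:P%:P * (1 + 'X%:P * 'X) : {poly {poly C}}) ^+ n)`_j`_j = c ^+ n *+ 'C(n, j).
    rewrite exprMn eN coefCM coefCM -mulr_natr; congr (_ * _).
    rewrite exprDn coef_sum coef_sum (bigD1 j)//= big1 ?addr0.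
      by rewrite expr1n mul1r eX !coefMn coefCM coefXn eqxx mulr1 coefXn eqxx.
    move=> i ij; rewrite expr1n mul1r eX !coefMn coefCM coefXn.
    by rewrite (negbTE (_ : j != i :> nat)) ?mulr0 ?coef0 ?mul0rn// eq_sym.
  rewrite FE xy G -mulr_natr rmorphM rmorphXn rmorphD rmorph1 rmorph_nat /= sqmodE normCK.
  by rewrite [_ * z0]mulrC.
apply: (@complexI R); rewrite rmorph_sum /= -Fjj Gjj //.
Qed.

End LocalExpansion.

(** * Numerical estimates *)
Section Numerics.
Variable R : realType.
Implicit Types t x y : R.

Lemma sum_pow4_le m : \sum_(j < m) (4^-1 : R) ^+ j <= 4 / 3.
Proof.
suff -> : \sum_(j < m) (4^-1 : R) ^+ j = 4 / 3 * (1 - 4^-1 ^+ m).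
  by rewrite ler_piMr// gerBl exprn_ge0.
elim: m => [|m IH]; first by rewrite big_ord0 expr0 subrr mulr0.
by rewrite big_ord_recr /= IH exprS; field.
Qed.

Lemma le_half_sum t x y c : 0 <= t -> 0 <= x -> 0 <= y -> 0 < c -> t ^+ 2 <= x * y ->
  t <= (x / c + c * y) / 2.
Proof.
move=> t0 x0 y0 c0 txy.
have x1 : 0 <= x / c by rewrite divr_ge0// ltW.
have y1 : 0 <= c * y by rewrite mulr_ge0// ltW.
have E : x * y = (x / c) * (c * y) by field; rewrite gt_eqF.
rewrite E in txy; rewrite -(@ler_pXn2r _ 2)// ?nnegrE ?divr_ge0 ?addr_ge0//.
apply: le_trans txy _.
by move: (x / c) (c * y) x1 y1 => a b a0 b0; have := sqr_ge0 (a - b); nra.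
Qed.

(** Bernoulli's inequality for negative increments. *)
Lemma bernoulli_sub t (n : nat) : 0 <= t -> t <= 1 -> 1 - n%:R * t <= (1 - t) ^+ n.
Proof.
move=> t0 t1; elim: n => [|n IH]; first by rewrite mul0r subr0 expr0.
have t1' : 0 <= 1 - t by rewrite subr_ge0.
have := ler_wpM2l t1' IH; rewrite -exprS -(natr1 n).
have n0 : 0 <= n%:R :> R by [].
by have := mulr_ge0 n0 (mulr_ge0 t0 t0); nra.
Qed.

(** Since (1 + t)(1 - t) <= 1, the lower bound 3/4 for (1 - t)^n suffices. *)
Lemma one_plus_pow_le t (n : nat) : 0 <= t -> n%:R * t <= 4^-1 -> (1 + t) ^+ n <= 4 / 3.
Proof.
move=> t0; case: n => [|n] nt; first by rewrite expr0; lra.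
have t1 : t <= 4^-1.
  by apply: le_trans nt; rewrite ler_peMl// ler1n.
have t1' : t <= 1 by lra.
have B := bernoulli_sub n.+1 t0 t1'.
have P34 : 3 / 4 <= (1 - t) ^+ n.+1 by apply: le_trans B; lra.
have H : (1 + t) ^+ n.+1 * (1 - t) ^+ n.+1 <= 1.
  rewrite -exprMn; apply: exprn_ile1; nra.
have p0 : 0 <= (1 + t) ^+ n.+1 by apply: exprn_ge0; lra.
have := ler_wpM2l p0 P34; lra.
Qed.

Lemma compound_le4 (n : nat) : (0 < n)%N -> (1 + n%:R^-1) ^+ n <= 4 :> R.
Proof.
move=> n0.
have h2 : expR (2^-1 : R) <= 2.
  have : 2^-1 <= expR (- 2^-1 : R).
    by apply: le_trans (expR_ge1Dx _); lra.
  by rewrite expRN lef_pV2 ?posrE ?expR_gt0.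
have h1 : expR (1 : R) <= 4.
  have -> : (1 : R) = 2^-1 + 2^-1 by field.
  rewrite expRD; have := expR_ge0 (2^-1 : R); nra.
apply: le_trans h1.
have -> : expR (1 : R) = expR (n%:R^-1) ^+ n.
  by rewrite -expRM_natl mulfV// pnatr_eq0 -lt0n.
by apply: lerXn2r; rewrite ?nnegrE ?expR_ge0 ?addr_ge0 ?invr_ge0// expR_ge1Dx.
Qed.

(** The numerical inequalities behind a good disc: at the centre, the constant
    15 k of q beats two noises of size 7 k; on the boundary, the value
    180 k / 6 = 30 k of p beats 15 k plus two noises. *)
Lemma center_gap (k x y z : R) : 0 < k -> 15 * k <= x + y -> y <= 7 * k -> z <= 7 * k -> z < x.
Proof. lra. Qed.

Lemma circle_gap (k x z g q : R) : 0 < k -> q <= 7 * k + 15 * k -> 180 * k * g <= x + z ->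
  z <= 7 * k -> 180 * k * 6^-1 <= 180 * k * g -> q < x.
Proof. move=> k0 H1 H2 H3 H4; have := le_trans H4 H2; lra. Qed.

Local Notation C := (Cplx R).

(** The remainder is a polynomial in y with nonnegative coefficients. *)
Lemma binomial_remainder (y : C) (n : nat) :
  cabs ((1 + y) ^+ n - 1 - n%:R * y) <= (1 + cabs y) ^+ n - 1 - n%:R * cabs y.
Proof.
elim: n => [|n IH].
  by rewrite !expr0 !mul0r !subr0 !subrr cabs_real.
have E : (1 + y) ^+ n.+1 - 1 - n.+1%:R * y = (1 + y) * ((1 + y) ^+ n - 1 - n%:R * y) + n%:R * y ^+ 2.
  by rewrite exprS -(natr1 n); ring.
have E' : (1 + cabs y) ^+ n.+1 - 1 - n.+1%:R * cabs y =
   (1 + cabs y) * ((1 + cabs y) ^+ n - 1 - n%:R * cabs y) + n%:R * cabs y ^+ 2.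
  by rewrite exprS -(natr1 n); ring.
rewrite E E'; apply: le_trans (cabsD _ _) _; rewrite cabsM [cabs (n%:R * _)]cabsM cabsX.
have -> : cabs (n%:R : C) = n%:R by rewrite -(rmorph_nat (real_complex R)) cabs_real.
rewrite lerD2r; apply: ler_pM => //; rewrite ?cabs_ge0//.
have c1 : cabs (1 : C) = 1 by exact: (cabs_real ler01).
by apply: le_trans (cabsD _ _) _; rewrite c1.
Qed.

(** The linear term has modulus 1/4 and the remainder at most
    4/3 - 1 - 1/4 = 1/12. *)
Lemma binomial_gap (y : C) (n : nat) : n%:R * cabs y = 4^-1 -> 6^-1 <= cabs ((1 + y) ^+ n - 1).
Proof.
move=> ny; have H1 := binomial_remainder y n.
have H2 := one_plus_pow_le (cabs_ge0 y) (_ : n%:R * cabs y <= 4^-1).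
rewrite ny lexx in H2; have {}H2 := H2 isT.
have E : n%:R * y = ((1 + y) ^+ n - 1) + - ((1 + y) ^+ n - 1 - n%:R * y) by ring.
have H3 : n%:R * cabs y <= cabs ((1 + y) ^+ n - 1) + cabs ((1 + y) ^+ n - 1 - n%:R * y).
  have -> : n%:R * cabs y = cabs (n%:R * y).
    by rewrite cabsM -(rmorph_nat (real_complex R)) cabs_real.
  by rewrite {1}E; apply: le_trans (cabsD _ _) _; rewrite cabsN.
rewrite ny in H3 H1; lra.
Qed.

(** Cauchy-Schwarz on |f(u)| <= sum_j |f_j| |u|^j, in the form of the
    arithmetic-geometric inequality for each term, with weight 5 kap. As
    |u|^2 <= 1/(4n), the weight n^-j leaves a convergent factor 4^-j. The
    resulting bound is (32/5 + 20/3) kap / 2 < 7 kap. *)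
Lemma weighted_sup (f : {poly C}) (n : nat) (u : C) (kap : R) : (0 < n)%N ->
  (size f <= n.+1)%N -> 0 < kap -> cabs u ^+ 2 <= (4 * n%:R)^-1 ->
  \sum_(j < n.+1) sqmod f`_j * n%:R^-1 ^+ j <= 32 * kap ^+ 2 -> cabs f.[u] <= 7 * kap.
Proof.
move=> n0 sf k0 u2 S; rewrite (horner_coef_wide _ sf).
apply: le_trans (cabs_sum _ _ _) _.
have c0 : 0 < 5 * kap by rewrite mulr_gt0.
apply: (@le_trans _ _ (\sum_(j < n.+1) (sqmod f`_j * n%:R^-1 ^+ j / (5 * kap) + 5 * kap * 4^-1 ^+ j) / 2)).
  apply: ler_sum => j _; apply: le_half_sum => //.
  - exact: cabs_ge0.
  - by rewrite mulr_ge0 ?sqmod_ge0 ?exprn_ge0 ?invr_ge0.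
  - rewrite cabs_sq sqmodM sqmodX -mulrA ler_wpM2l ?sqmod_ge0// -exprMn -invfM [n%:R * _]mulrC.
    by apply: lerXn2r; rewrite ?nnegrE ?sqmod_ge0 ?invr_ge0 ?mulr_ge0// -cabs_sq.
rewrite -big_distrl /= big_split /= -big_distrl -big_distrr /=.
have H4 := sum_pow4_le n.+1.
have HS : (\sum_(j < n.+1) sqmod f`_j * n%:R^-1 ^+ j) / (5 * kap) <= 32 / 5 * kap.
  by rewrite ler_pdivrMr//; apply: le_trans S _; nra.
have H5 := ler_wpM2l (ltW c0) H4.
lra.
Qed.

End Numerics.

(** * Coefficients that make a disc good *)
Section GoodCoefficients.
Variable R : realType.
Local Notation C := (Cplx R).
Variables (n : nat) (n0 : (0 < n)%N) (z0 : C) (z01 : `|z0| <= 1).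
Variables (rho kap : R) (rho0 : 0 < rho) (rho2 : rho ^+ 2 = (4 * n%:R)^-1).
Hypotheses (kap0 : 0 < kap) (kap2 : kap ^+ 2 = (1 + sqmod z0) ^+ n).

(** The j-th local coefficient of a random polynomial has variance
    (1 + |z0|^2)^n C(n,j) with C(n,j) <= n^j / j!, so the weights n^-j make the
    expected noise of order (1 + |z0|^2)^n = kap^2. *)
Definition noise (c : 'I_n.+1 -> C) : R :=
  \sum_(j < n.+1) sqmod (local_poly z0 c)`_j * n%:R^-1 ^+ j.

(** Coefficients of the polynomials that are constant 15 kap, respectively
    180 kap ((1 + rho u)^n - 1), in the local coordinate. The second one
    vanishes at the centre and has modulus at least 30 kap on |u| = rho. *)
Definition peak_q (k : 'I_n.+1) : C := ((15 / kap)%:C)%C * binom_coefs 1 z0^* k.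
Definition peak_p (k : 'I_n.+1) : C := ((180 / kap)%:C)%C *
  (binom_coefs (1 - (rho%:C)%C * z0) (z0^* + (rho%:C)%C) k - binom_coefs 1 z0^* k).

Lemma local_polyZB (x : C) (c c' : 'I_n.+1 -> C) :
  local_poly z0 (fun k => x * (c k - c' k)) = x *: (local_poly z0 c - local_poly z0 c').
Proof.
rewrite -sumrB scaler_sumr; apply: eq_bigr => k _.
by rewrite -scalerBl scalerA.
Qed.

Lemma conjM_sqmod : z0^* * z0 = ((sqmod z0)%:C)%C.
Proof. by rewrite sqmodE normCK mulrC. Qed.

Lemma oneC (x : R) : 1 + (x%:C)%C = ((1 + x)%:C)%C :> C.
Proof. by rewrite rmorphD rmorph1. Qed.

Lemma local_peak_q u : (local_poly z0 peak_q).[u] = ((15 * kap)%:C)%C.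
Proof.
have -> : local_poly z0 peak_q = ((15 / kap)%:C)%C *: local_poly z0 (@binom_coefs R n 1 z0^*).
  by rewrite scaler_sumr; apply: eq_bigr => k _; rewrite scalerA.
rewrite hornerZ local_binom.
have -> : 1 * (1 - z0^* * u) + z0^* * (u + z0) = 1 + z0^* * z0 by ring.
rewrite conjM_sqmod oneC -rmorphXn -rmorphM; congr (_%:C)%C.
by rewrite -kap2; field; rewrite gt_eqF.
Qed.

Lemma local_peak_p u : (local_poly z0 peak_p).[u] =
  ((180 * kap)%:C)%C * ((1 + (rho%:C)%C * u) ^+ n - 1).
Proof.
rewrite local_polyZB !hornerE !local_binom.
have -> : 1 * (1 - z0^* * u) + z0^* * (u + z0) = 1 + z0^* * z0 by ring.
have -> : (1 - (rho%:C)%C * z0) * (1 - z0^* * u) + (z0^* + (rho%:C)%C) * (u + z0) =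
  (1 + z0^* * z0) * (1 + (rho%:C)%C * u) by ring.
rewrite exprMn -{2}[(1 + z0^* * z0) ^+ n]mulr1 -mulrBr mulrA; congr (_ * _).
rewrite conjM_sqmod oneC -rmorphXn -rmorphM; congr (_%:C)%C.
by rewrite -kap2; field; rewrite gt_eqF.
Qed.

Lemma rho_le_half : rho <= 2^-1.
Proof.
rewrite -(@ler_pXn2r _ 2)// ?nnegrE ?invr_ge0 ?(ltW rho0)// rho2.
have -> : 2^-1 ^+ 2 = 4^-1 :> R by field.
rewrite lef_pV2 ?posrE ?mulr_gt0 ?ltr0n//.
have : 1 <= n%:R :> R by rewrite ler1n.
by lra.
Qed.

(** The boundary of the disc is the image of the circle |u| = rho. *)
Lemma pcircle_ppoint z : pcircle z0 rho z ->
  exists2 u, cabs u = rho & 1 - z0^* * u != 0 /\ z = ppoint z0 u.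
Proof.
rewrite /pcircle /= => zC.
have N0 : 1 + z0^* * z0 != 0.
  rewrite mulrC -normCK gt_eqF// ltr_wpDr// exprn_ge0//.
have v0 : 1 + z0^* * z != 0.
  apply/negP => /eqP v0; move: zC; rewrite v0 normr0 mulr0 => /eqP.
  rewrite normr_eq0 subr_eq0 => /eqP zz; move: v0; rewrite zz => /eqP.
  by rewrite (negbTE N0).
have dE : 1 - z0^* * ((z - z0) / (1 + z0^* * z)) = (1 + z0^* * z0) / (1 + z0^* * z).
  by field.
exists ((z - z0) / (1 + z0^* * z)).
  apply: (@complexI R); rewrite cabsE normf_div zC mulfK ?normr_eq0//.
split; first by rewrite dE mulf_neq0// invr_eq0.
rewrite /ppoint dE; field.
by rewrite v0 N0.
Qed.

(** Small noise is at most 7 kap in the whole disc, which is dominated by the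
    peaks. *)
Lemma good_disc_of_noise (p q : 'I_n.+1 -> C) :
  noise p <= 32 * kap ^+ 2 -> noise q <= 32 * kap ^+ 2 ->
  good_disc (coef_poly_of (fun k => p k + peak_p k)) (coef_poly_of (fun k => q k + peak_q k)) z0 rho.
Proof.
move=> Np Nq.
have sup (c : 'I_n.+1 -> C) u : noise c <= 32 * kap ^+ 2 -> cabs u ^+ 2 <= rho ^+ 2 ->
    cabs (local_poly z0 c).[u] <= 7 * kap.
  by move=> Nc u2; apply: (weighted_sup n0 (size_local_poly z0 c)) => //; rewrite -rho2.
have pE u : (local_poly z0 (fun k => p k + peak_p k)).[u] =
    (local_poly z0 p).[u] + ((180 * kap)%:C)%C * ((1 + (rho%:C)%C * u) ^+ n - 1).
  by rewrite local_polyD hornerD local_peak_p.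
have qE u : (local_poly z0 (fun k => q k + peak_q k)).[u] = (local_poly z0 q).[u] + ((15 * kap)%:C)%C.
  by rewrite local_polyD hornerD local_peak_q.
have k15 : 0 <= 15 * kap by rewrite mulr_ge0// ltW.
have k180 : 0 <= 180 * kap by rewrite mulr_ge0// ltW.
split.
  have z0E : ppoint z0 0 = z0 by rewrite /ppoint add0r mulr0 subr0 divr1.
  have d0 : 1 - z0^* * 0 != 0 :> C by rewrite mulr0 subr0 oner_eq0.
  have E c : (local_poly z0 c).[0] = (coef_poly_of c).[z0].
    by rewrite (horner_local_poly _ d0) z0E mulr0 subr0 expr1n mul1r.
  rewrite -!E pE qE !mulr0 addr0 expr1n subrr mulr0 addr0 -!cabsE ltcR.
  have c00 : cabs (0 : C) ^+ 2 <= rho ^+ 2 by rewrite cabs_real// expr0n sqr_ge0.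
  have Bp := sup p 0 Np c00; have Bq := sup q 0 Nq c00.
  have : 15 * kap <= cabs ((local_poly z0 q).[0] + ((15 * kap)%:C)%C) + cabs (local_poly z0 q).[0].
    rewrite -{1}(cabs_real k15).
    have {1}-> : ((15 * kap)%:C)%C = ((local_poly z0 q).[0] + ((15 * kap)%:C)%C) + - (local_poly z0 q).[0] by ring.
    by apply: le_trans (cabsD _ _) _; rewrite cabsN.
  by move=> H; exact: (center_gap kap0 H Bq Bp).
move=> z /pcircle_ppoint[u ur [d0 ->]].
suff : cabs (local_poly z0 (fun k => q k + peak_q k)).[u] <
       cabs (local_poly z0 (fun k => p k + peak_p k)).[u].
  rewrite !(horner_local_poly _ d0) !cabsM -(@ltcR R) !rmorphM /= !cabsE ltr_pM2l//.
  by rewrite normr_gt0 expf_neq0.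
have u2 : cabs u ^+ 2 <= rho ^+ 2 by rewrite ur.
have Bp := sup p u Np u2; have Bq := sup q u Nq u2.
rewrite pE qE.
have ru : n%:R * cabs ((rho%:C)%C * u) = 4^-1.
  rewrite cabsM ur cabs_real ?ltW// -expr2 rho2 invfM mulrCA mulfV ?mulr1//.
  by rewrite pnatr_eq0 -lt0n.
have gap := binomial_gap ru.
have H1 : cabs ((local_poly z0 q).[u] + ((15 * kap)%:C)%C) <= 7 * kap + 15 * kap.
  by apply: le_trans (cabsD _ _) _; rewrite (cabs_real k15) lerD2r.
have H2 : cabs (((180 * kap)%:C)%C * ((1 + (rho%:C)%C * u) ^+ n - 1)) <=
   cabs ((local_poly z0 p).[u] + ((180 * kap)%:C)%C * ((1 + (rho%:C)%C * u) ^+ n - 1)) + cabs (local_poly z0 p).[u].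
  set X := _ * (_ - 1).
  have {1}-> : X = ((local_poly z0 p).[u] + X) + - (local_poly z0 p).[u] by ring.
  by apply: le_trans (cabsD _ _) _; rewrite cabsN.
rewrite cabsM (cabs_real k180) in H2.
exact: (circle_gap kap0 H1 H2 Bp (ler_wpM2l k180 gap)).
Qed.

(** The squared norm of the coefficients of (al + be X)^n is
    (|al|^2 + |be|^2)^n, which kap cancels; so the cost of the shift depends
    neither on n nor on z0. *)
Lemma norm_peak_q : \sum_k sqmod (peak_q k) / 'C(n, k)%:R = 225.
Proof.
rewrite /peak_q; under eq_bigr do rewrite sqmodM sqmod_real -mulrA.
rewrite -big_distrr /= sum_binom_coefs sqmod_conj.
have -> : sqmod (1 : C) = 1 by rewrite (sqmod_real 1) expr1n.
by rewrite -kap2; field; rewrite gt_eqF.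
Qed.

(** Here |al|^2 + |be|^2 = (1 + rho^2)(1 + |z0|^2), and (1 + rho^2)^n is
    bounded because n rho^2 = 1/4. *)
Lemma norm_peak_p : \sum_k sqmod (peak_p k) / 'C(n, k)%:R <= 5 * 180 ^+ 2.
Proof.
have kk : 0 < kap ^+ 2 by rewrite exprn_gt0.
pose al : C := 1 - (rho%:C)%C * z0; pose be : C := z0^* + (rho%:C)%C.
have nab : sqmod al + sqmod be = (1 + rho ^+ 2) * (1 + sqmod z0).
  rewrite /al /be; case: (z0) => x y; rewrite /sqmod /=; ring.
have bound k : sqmod (peak_p k) / 'C(n, k)%:R <= (180 / kap) ^+ 2 *
   (2 * (sqmod (binom_coefs al be k) / 'C(n, k)%:R) + 2 * (sqmod (binom_coefs 1 z0^* k) / 'C(n, k)%:R)).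
  rewrite /peak_p sqmodM sqmod_real -mulrA ler_wpM2l ?sqr_ge0// !mulrA -mulrDl.
  by rewrite ler_wpM2r ?invr_ge0// sqmodB_le.
apply: le_trans (ler_sum _ (fun k _ => bound k)) _.
rewrite -big_distrr big_split /= -!big_distrr /= !sum_binom_coefs sqmod_conj nab.
have -> : sqmod (1 : C) = 1 by rewrite (sqmod_real 1) expr1n.
rewrite [((1 + rho ^+ 2) * _) ^+ n]exprMn -kap2.
have H : (1 + rho ^+ 2) ^+ n <= 4 / 3.
  apply: one_plus_pow_le; first exact: sqr_ge0.
  by rewrite rho2 invfM mulrCA mulfV ?mulr1// pnatr_eq0 -lt0n.
have -> : (180 / kap) ^+ 2 * (2 * ((1 + rho ^+ 2) ^+ n * kap ^+ 2) + 2 * kap ^+ 2) =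
   180 ^+ 2 * (2 * (1 + rho ^+ 2) ^+ n + 2) by field; rewrite gt_eqF.
by lra.
Qed.

End GoodCoefficients.

(** * Probability that a disc is good *)
(** The integral of a nonnegative function is a supremum over simple functions
    below it. Thanks to this, the number of components can be bounded in
    expectation without a proof that it is measurable. *)
Lemma le_integral_nonmeasurable (R : realType) (d : measure_display) (T : measurableType d)
  (mu : {measure set T -> \bar R}) (f g : T -> \bar R) :
  (forall w, 0 <= f w)%E -> (forall w, f w <= g w)%E -> (\int[mu]_w f w <= \int[mu]_w g w)%E.
Proof.
move=> f0 fg; have g0 w : (0 <= g w)%E by exact: le_trans (f0 w) (fg w).
rewrite !ge0_integralTE//; apply: ereal_sup_le => _ [h hf <-].
by exists h => // w; apply: le_trans (hf w) (fg w).
Qed.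

Section GoodEvent.
Variable R : realType.
Local Notation C := (Cplx R).

Lemma measurable_noise (n : nat) (z0 : C) (d : measure_display) (T : measurableType d)
  (Z : 'I_n.+1 -> T -> C) :
  (forall k, measurable_fun setT (fun w => complex.Re (Z k w))) ->
  (forall k, measurable_fun setT (fun w => complex.Im (Z k w))) ->
  measurable_fun setT (fun w => noise z0 (fun k => Z k w)).
Proof.
move=> mRe mIm; apply: measurable_sum => j; apply: measurable_funM => //.
under eq_fun do rewrite coef_local_poly.
exact: measurable_sqmod_sum.
Qed.

Lemma noise_ge0 (n : nat) (z0 : C) (c : 'I_n.+1 -> C) : 0 <= noise z0 c.
Proof. by apply: sumr_ge0 => j _; rewrite mulr_ge0 ?sqmod_ge0// exprn_ge0// invr_ge0. Qed.

Definition energy_bound : R := 5 * 180 ^+ 2.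

Lemma tilt_level_gt0 : 0 < 8 * 144 * energy_bound.
Proof. by apply: mulr_gt0; [exact: mulr_gt0 | apply: mulr_gt0 => //; exact: exprn_gt0]. Qed.

(** Here c is the variance of a complex coefficient and t = s^2 that of its real
    and imaginary parts. The constant 12 is twice that of
    [normal_second_moment_le]. *)
Lemma variance_ratio (x c t : R) : 0 <= x -> 0 < c -> 0 < t -> c <= 12 * t ->
  x * t^-1 ^+ 2 * c <= 144 * (x / c) /\ x / (2 * t) <= 6 * (x / c).
Proof.
move=> x0 c0 t0 ct; have u12 : c / t <= 12 by rewrite ler_pdivrMr.
have u0 : 0 <= c / t by rewrite divr_ge0// ltW.
have xc0 : 0 <= x / c by rewrite divr_ge0// ltW.
split.
  have -> : x * t^-1 ^+ 2 * c = (c / t) ^+ 2 * (x / c) by field; rewrite !gt_eqF.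
  by rewrite ler_wpM2r//; nra.
have -> : x / (2 * t) = (c / t) / 2 * (x / c) by field; rewrite !gt_eqF.
by rewrite ler_wpM2r//; lra.
Qed.

Section OneFamily.
Context (d : measure_display) (T : measurableType d) (P : probability T R).
Variables (n : nat) (n0 : (0 < n)%N) (a : 'I_n.+1 -> T -> C).
Hypothesis mRe : forall i, measurable_fun setT (fun w => complex.Re (a i w)).
Hypothesis mIm : forall i, measurable_fun setT (fun w => complex.Im (a i w)).
Hypothesis cov : forall i j, complex_expectation P (fun w => a i w * (a j w)^*)
  = if i == j then (('C(n, i)%:R : R)%:C)%C else 0.

Lemma binR_gt0 (i : 'I_n.+1) : (0 : R) < 'C(n, i)%:R.
Proof. by rewrite ltr0n bin_gt0 -ltnS. Qed.

Lemma integral_noise (z0 : C) : (\int[P]_w (noise z0 (fun k => a k w))%:E =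
  ((1 + sqmod z0) ^+ n * (1 + n%:R^-1) ^+ n)%:E)%E.
Proof.
pose g (j : 'I_n.+1) w : R := sqmod (\sum_(k < n.+1) (local_basis n z0 k)`_j * a k w).
have Ig j : (\int[P]_w (g j w)%:E = ((1 + sqmod z0) ^+ n * 'C(n, j)%:R)%:E)%E.
  rewrite /g (integral_sqmod_sum mRe mIm binR_gt0 cov (fun k => (local_basis n z0 k)`_j)).
  by rewrite -sum_local_basis.
transitivity (\int[P]_w (\sum_(j < n.+1) (n%:R^-1 ^+ j)%:E * (g j w)%:E))%E.
  apply: eq_integral => w _; rewrite /noise -sumEFin; apply: eq_bigr => j _.
  by rewrite -EFinM mulrC coef_local_poly.
have mg j : measurable_fun setT (g j) by exact: measurable_sqmod_sum.
rewrite ge0_integral_sum//; last 2 first.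
- by move=> j; apply: measurable_funeM; exact/measurable_EFinP.
- by move=> j w _; rewrite -EFinM lee_fin mulr_ge0 ?sqmod_ge0// exprn_ge0// invr_ge0.
transitivity (\sum_(j < n.+1) (n%:R^-1 ^+ j * ((1 + sqmod z0) ^+ n * 'C(n, j)%:R))%:E)%E.
  apply: eq_bigr => j _; rewrite ge0_integralZl_EFin ?Ig//; first by move=> w _; rewrite lee_fin sqmod_ge0.
  exact/measurable_EFinP.
rewrite sumEFin [(1 + n%:R^-1) ^+ n]exprDn big_distrr /=; congr (_%:E); apply: eq_bigr => j _.
by rewrite expr1n mul1r -mulr_natr; ring.
Qed.

Lemma noise_large_prob (z0 : C) (kap : R) : 0 < kap -> kap ^+ 2 = (1 + sqmod z0) ^+ n ->
  (P [set w | (32 * kap ^+ 2 < noise z0 (fun k => a k w))%R] <= (8^-1)%:E)%E /\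
  measurable [set w | (32 * kap ^+ 2 < noise z0 (fun k => a k w))%R].
Proof.
move=> k0 k2; have kk : 0 < kap ^+ 2 by rewrite exprn_gt0.
have t0 : 0 < 32 * kap ^+ 2 by rewrite mulr_gt0.
have [H1 H2] := markov_ge0 (measurable_noise z0 mRe mIm) (fun w => noise_ge0 z0 _) (integral_noise z0) t0.
split => //; apply: le_trans H1 _; rewrite lee_fin ler_pdivrMr// -k2.
by have := compound_le4 R n0; nra.
Qed.

Variables (s : 'I_n.+1 -> R) (s0 : forall k, 0 < s k).
Hypothesis var_s : forall k : 'I_n.+1, 'C(n, k)%:R <= 12 * s k ^+ 2.
Variable h : 'I_n.+1 -> C.
Hypothesis hE : \sum_k sqmod (h k) / 'C(n, k)%:R <= energy_bound.

(** Its real part is the linear term in the exponent of the Cameron-Martin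
    weight for the shift [h]. *)
Definition tilt w : C := \sum_k ((h k)^* * ((s k ^- 2)%:C)%C) * a k w.

Lemma tilt_large_prob :
  (P [set w | (8 * 144 * energy_bound < sqmod (tilt w))%R] <= (8^-1)%:E)%E /\
  measurable [set w | (8 * 144 * energy_bound < sqmod (tilt w))%R].
Proof.
have t0 : 0 < 8 * 144 * energy_bound by exact: tilt_level_gt0.
have [H1 H2] := markov_ge0 (measurable_sqmod_sum mRe mIm _) (fun w => sqmod_ge0 _)
  (integral_sqmod_sum mRe mIm binR_gt0 cov (fun k => (h k)^* * ((s k ^- 2)%:C)%C)) t0.
split => //; apply: le_trans H1 _; rewrite lee_fin ler_pdivrMr//.
apply: (@le_trans _ _ (\sum_k 144 * (sqmod (h k) / 'C(n, k)%:R))).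
  apply: ler_sum => k _; rewrite sqmodM sqmod_conj sqmod_real.
  exact: (variance_ratio (sqmod_ge0 _) (binR_gt0 k) (exprn_gt0 2 (s0 k)) (var_s k)).1.
rewrite -big_distrr /=; have := ler_wpM2l (ler0n R 144) hE.
have -> : 8^-1 * (8 * 144 * energy_bound) = 144 * energy_bound by field.
by [].
Qed.

Lemma energy_le : \sum_k sqmod (h k) / (2 * s k ^+ 2) <= 6 * energy_bound.
Proof.
apply: (@le_trans _ _ (\sum_k 6 * (sqmod (h k) / 'C(n, k)%:R))).
  apply: ler_sum => k _.
  exact: (variance_ratio (sqmod_ge0 _) (binR_gt0 k) (exprn_gt0 2 (s0 k)) (var_s k)).2.
by rewrite -big_distrr /= ler_wpM2l.
Qed.

(** The linear term is estimated by Re z <= (1 + |z|^2) / 2, the quadratic one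
    by [energy_le]. *)
Lemma tilt_bound w : sqmod (tilt w) <= 8 * 144 * energy_bound ->
  \sum_k (complex.Re (a k w) * complex.Re (h k) + complex.Im (a k w) * complex.Im (h k)) / s k ^+ 2
   + \sum_k sqmod (h k) / (2 * s k ^+ 2) <= (1 + 8 * 144 * energy_bound) / 2 + 6 * energy_bound.
Proof.
move=> tb; apply: lerD; last exact: energy_le.
have -> : \sum_k (complex.Re (a k w) * complex.Re (h k) + complex.Im (a k w) * complex.Im (h k)) / s k ^+ 2
   = complex.Re (tilt w).
  rewrite /tilt Re_sum; apply: eq_bigr => k _.
  rewrite -Re_mulconj; case: (a k w) (h k) => x y [x' y'] /=; ring.
move: tb; rewrite /sqmod; move: (complex.Re _) (complex.Im _) (8 * 144 * energy_bound) => x y t tb.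
have h1 := sqr_ge0 (x - 1); have h2 := sqr_ge0 y; nra.
Qed.

End OneFamily.

(** The bound of [tilt_bound], once for p and once for q. *)
Definition log_cost : R := 2 * ((1 + 8 * 144 * energy_bound) / 2 + 6 * energy_bound).

Section TwoFamilies.
Context (d : measure_display) (T : measurableType d) (P : probability T R).
Variables (n : nat) (n0 : (0 < n)%N) (a b : 'I_n.+1 -> T -> C).
Hypothesis gauss_a : forall k, centered_complex_gaussian P (a k).
Hypothesis gauss_b : forall k, centered_complex_gaussian P (b k).
Hypothesis indep : mutually_independent P (family_pair a b).
Hypothesis cov_a : forall j k, complex_expectation P (fun w => a j w * Num.conj (a k w))
  = if j == k then ('C(n, k))%:R else 0.
Hypothesis cov_b : forall j k, complex_expectation P (fun w => b j w * Num.conj (b k w))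
  = if j == k then ('C(n, k))%:R else 0.

Let I := ('I_n.+1 + 'I_n.+1)%type.
Let Z : I -> T -> C := family_pair a b.

Let gauss_Z i : centered_complex_gaussian P (Z i).
Proof. by case: i => k; [exact: gauss_a | exact: gauss_b]. Qed.

(** The Gaussian vector of all real and imaginary parts of the coefficients of
    both polynomials. *)
Definition coordinate (k : I * bool) (w : T) : R :=
  if k.2 then complex.Re (Z k.1 w) else complex.Im (Z k.1 w).

Lemma measurable_coordinate k : measurable_fun setT (coordinate k).
Proof.
have [/measurable_fun_pairP[mR mI] _] := gauss_Z k.1.
by rewrite /coordinate; case: k.2; [exact: mR | exact: mI].
Qed.

Lemma std_exists : exists s : I -> R, (forall i, 0 < s i) /\
  (forall i A B, measurable A -> measurable B -> P (real_pair (Z i) @^-1` (A `*` B)) =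
     (normal_prob 0 (s i) A * normal_prob 0 (s i) B)%E).
Proof.
have /choice[s sP] : forall i, exists s : R, 0 < s /\ forall A B, measurable A -> measurable B ->
    P (real_pair (Z i) @^-1` (A `*` B)) = (normal_prob 0 s A * normal_prob 0 s B)%E.
  by move=> i; have [_ [s s0 H]] := gauss_Z i; exists s.
by exists s; split => i; have [] := sP i.
Qed.

Section FixedStd.
Variables (s : I -> R) (s0 : forall i, 0 < s i).
Hypothesis law : forall i A B, measurable A -> measurable B ->
  P (real_pair (Z i) @^-1` (A `*` B)) = (normal_prob 0 (s i) A * normal_prob 0 (s i) B)%E.

(** Independence of the complex variables, and of the two parts of each of
    them, combined in one product formula. *)
Lemma coordinate_rect (A : I * bool -> set R) : (forall k, measurable (A k)) ->
  P [set w | forall k, A k (coordinate k w)] = (\prod_k normal_prob 0 (s k.1) (A k))%E.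
Proof.
move=> mA; have mA' i : measurable (A (i, true) `*` A (i, false)) by exact: measurableX.
have := indep [set: I]%SET mA'.
have -> : \bigcap_(i in [set` [set: I]%SET]) (real_pair (Z i) @^-1` (A (i, true) `*` A (i, false)))
    = [set w | forall k, A k (coordinate k w)].
  apply/seteqP; split => w /= H; last by move=> i _; split; [exact: (H (i, true)) | exact: (H (i, false))].
  by move=> [i c]; have [] := H i (finset.in_setT i); case: c.
move=> ->; under eq_bigl do rewrite finset.in_setT.
rewrite (eq_bigr (fun k => normal_prob 0 (s (k.1, k.2).1) (A (k.1, k.2)))); last by case.
rewrite -(pair_bigA _ (fun i c => normal_prob 0 (s i) (A (i, c)))) /=.
by apply: eq_bigr => i _; rewrite law// big_bool.
Qed.

Lemma coordinate_law k A : measurable A -> P (coordinate k @^-1` A) = normal_prob 0 (s k.1) A.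
Proof.
move=> mA; case: k => i c /=.
have pT : normal_prob 0 (s i) setT = 1%E by exact: probability_setT.
have -> : coordinate (i, c) @^-1` A = real_pair (Z i) @^-1`
    ((if c then A else setT) `*` (if c then setT else A)).
  by apply/seteqP; split => w; rewrite /coordinate; case: c => //=; case.
by rewrite law//; case: c => //; rewrite pT ?mule1 ?mul1e.
Qed.

(** Links the standard deviation s_i of the Gaussian law with the prescribed
    covariance: the real and the imaginary part contribute at most 6 s_i^2
    each. *)
Lemma variance_le (i : I) (c : R) : 0 < c ->
  complex_expectation P (fun w => Z i w * (Z i w)^*) = (c%:C)%C -> c <= 12 * s i ^+ 2.
Proof.
move=> c0 E.
have mR : measurable_fun setT (fun w => complex.Re (Z i w)) by exact: (measurable_coordinate (i, true)).
have mI : measurable_fun setT (fun w => complex.Im (Z i w)) by exact: (measurable_coordinate (i, false)).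
have := @integral_sqmod R d T P unit (fun _ w => Z i w) (fun=> c) (fun=> c0)
  (fun _ _ => E) tt.
rewrite /sqmod => IE; rewrite -lee_fin -IE.
under eq_integral do rewrite EFinD.
rewrite ge0_integralD//; last 4 first.
- by move=> w _; rewrite lee_fin sqr_ge0.
- by apply/measurable_EFinP; exact: measurable_funX.
- by move=> w _; rewrite lee_fin sqr_ge0.
- by apply/measurable_EFinP; exact: measurable_funX.
have -> : 12 * s i ^+ 2 = 6 * s i ^+ 2 + 6 * s i ^+ 2 by ring.
rewrite EFinD; apply: leeD.
  apply: (gaussian_variance_le mR (s0 i)) => A mA; exact: (coordinate_law (i, true) mA).
apply: (gaussian_variance_le mI (s0 i)) => A mA; exact: (coordinate_law (i, false) mA).
Qed.

Variables (z0 : C) (z01 : `|z0| <= 1) (rho kap : R).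
Hypotheses (rho0 : 0 < rho) (rho2 : rho ^+ 2 = (4 * n%:R)^-1).
Hypotheses (kap0 : 0 < kap) (kap2 : kap ^+ 2 = (1 + sqmod z0) ^+ n).

Let cov_a' i j : complex_expectation P (fun w => a i w * (a j w)^*)
  = if i == j then (('C(n, i)%:R : R)%:C)%C else 0.
Proof. by rewrite cov_a; case: eqP => // ->; rewrite rmorph_nat. Qed.

Let cov_b' i j : complex_expectation P (fun w => b i w * (b j w)^*)
  = if i == j then (('C(n, i)%:R : R)%:C)%C else 0.
Proof. by rewrite cov_b; case: eqP => // ->; rewrite rmorph_nat. Qed.

Let mRea k : measurable_fun setT (fun w => complex.Re (a k w)).
Proof. exact: (measurable_coordinate (inl k, true)). Qed.
Let mIma k : measurable_fun setT (fun w => complex.Im (a k w)).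
Proof. exact: (measurable_coordinate (inl k, false)). Qed.
Let mReb k : measurable_fun setT (fun w => complex.Re (b k w)).
Proof. exact: (measurable_coordinate (inr k, true)). Qed.
Let mImb k : measurable_fun setT (fun w => complex.Im (b k w)).
Proof. exact: (measurable_coordinate (inr k, false)). Qed.

Let var_a (k : 'I_n.+1) : 'C(n, k)%:R <= 12 * s (inl k) ^+ 2.
Proof. by apply: (variance_le (binR_gt0 k)); rewrite /= cov_a' eqxx. Qed.
Let var_b (k : 'I_n.+1) : 'C(n, k)%:R <= 12 * s (inr k) ^+ 2.
Proof. by apply: (variance_le (binR_gt0 k)); rewrite /= cov_b' eqxx. Qed.

Let hp := @peak_p R n z0 rho kap.
Let hq := @peak_q R n z0 kap.
Let peak (i : I) : C := match i with inl k => hp k | inr k => hq k end.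
Let shift (k : I * bool) : R := if k.2 then complex.Re (peak k.1) else complex.Im (peak k.1).

Let hpE : \sum_k sqmod (hp k) / 'C(n, k)%:R <= energy_bound.
Proof. exact: norm_peak_p. Qed.
Let hqE : \sum_k sqmod (hq k) / 'C(n, k)%:R <= energy_bound.
Proof. by rewrite /hq norm_peak_q// /energy_bound; lra. Qed.

Let Na : set T := [set w | 32 * kap ^+ 2 < noise z0 (fun k => a k w)].
Let Nb : set T := [set w | 32 * kap ^+ 2 < noise z0 (fun k => b k w)].
Let La : set T := [set w | 8 * 144 * energy_bound < sqmod (tilt a (fun k => s (inl k)) hp w)].
Let Lb : set T := [set w | 8 * 144 * energy_bound < sqmod (tilt b (fun k => s (inr k)) hq w)].

Let Na_small : (P Na <= (8^-1)%:E)%E /\ measurable Na.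
Proof. exact: noise_large_prob. Qed.
Let Nb_small : (P Nb <= (8^-1)%:E)%E /\ measurable Nb.
Proof. exact: noise_large_prob. Qed.
Let La_small : (P La <= (8^-1)%:E)%E /\ measurable La.
Proof. exact: tilt_large_prob. Qed.
Let Lb_small : (P Lb <= (8^-1)%:E)%E /\ measurable Lb.
Proof. exact: tilt_large_prob. Qed.

(** Outside four events of probability at most 1/8 both noises are small and
    the exponent of the Cameron-Martin weight is bounded. *)
Let E : set T := ~` (Na `|` Nb `|` La `|` Lb).

Let mE : measurable E.
Proof.
apply: measurableC; apply: measurableU; last exact: Lb_small.2.
apply: measurableU; last exact: La_small.2.
by apply: measurableU; [exact: Na_small.2 | exact: Nb_small.2].
Qed.

Let E_half : ((2^-1)%:E <= P E)%E.
Proof.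
have mU : measurable (Na `|` Nb `|` La `|` Lb) by rewrite -[X in measurable X]setCK; exact: measurableC.
rewrite probability_setC//.
have : (P (Na `|` Nb `|` La `|` Lb) <= (8^-1)%:E + (8^-1)%:E + (8^-1)%:E + (8^-1)%:E)%E.
  have mNa := Na_small.2; have mNb := Nb_small.2; have mLa := La_small.2; have mLb := Lb_small.2.
  have m1 := measurableU _ _ mNa mNb; have m2 := measurableU _ _ m1 mLa.
  apply: le_trans (measureU2 _ m2 mLb) _; apply: leeD; last exact: Lb_small.1.
  apply: le_trans (measureU2 _ m1 mLa) _; apply: leeD; last exact: La_small.1.
  by apply: le_trans (measureU2 _ mNa mNb) _; apply: leeD; [exact: Na_small.1 | exact: Nb_small.1].
have fU : P (Na `|` Nb `|` La `|` Lb) \is a fin_num by exact: fin_num_measure.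
rewrite -(fineK fU) -!EFinD !lee_fin => H.
change ((2^-1)%:E <= 1%:E - (fine (P (Na `|` Nb `|` La `|` Lb)))%:E)%E.
by rewrite -EFinB lee_fin; lra.
Qed.

(** Coefficient vectors whose difference with the peaks has small noise. *)
Definition good_set : set (I * bool -> R) :=
  [set y | noise z0 (fun k => (y (inl k, true) +i* y (inl k, false))%C - hp k) <= 32 * kap ^+ 2 /\
           noise z0 (fun k => (y (inr k, true) +i* y (inr k, false))%C - hq k) <= 32 * kap ^+ 2].

Local Notation Omega := (g_sigma_algebraType (@rectangles R ((('I_n.+1 + 'I_n.+1) * bool)%type))).

Lemma measurable_good_set : measurable (good_set : set Omega).
Proof.
have mc k : measurable_fun setT (fun y : Omega => y k) by exact: measurable_coord.
have mn (h : 'I_n.+1 -> C) (f : 'I_n.+1 -> I) : measurable (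
    [set y : Omega | noise z0 (fun k => (y (f k, true) +i* y (f k, false))%C - h k) <= 32 * kap ^+ 2]).
  have mN : measurable_fun setT (fun y : Omega => noise z0 (fun k => (y (f k, true) +i* y (f k, false))%C - h k)).
    apply: (@measurable_noise n z0 _ Omega (fun k y => (y (f k, true) +i* y (f k, false))%C - h k)) => k.
      have -> : (fun y : Omega => complex.Re ((y (f k, true) +i* y (f k, false))%C - h k)) =
          (fun y : Omega => y (f k, true) - complex.Re (h k)).
        by apply/funext => y; case: (h k).
      by apply: measurable_funB.
    have -> : (fun y : Omega => complex.Im ((y (f k, true) +i* y (f k, false))%C - h k)) =
        (fun y : Omega => y (f k, false) - complex.Im (h k)).
      by apply/funext => y; case: (h k).
    by apply: measurable_funB.
  have -> : [set y : Omega | noise z0 (fun k => (y (f k, true) +i* y (f k, false))%C - h k) <= 32 * kap ^+ 2]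
     = (fun y : Omega => noise z0 (fun k => (y (f k, true) +i* y (f k, false))%C - h k)) @^-1` `]-oo, 32 * kap ^+ 2]%classic.
    by apply/seteqP; split => y /=; rewrite in_itv.
  by rewrite -[X in measurable X]setTI; exact: mN.
have -> : (good_set : set Omega) =
   [set y : Omega | noise z0 (fun k => (y (inl k, true) +i* y (inl k, false))%C - hp k) <= 32 * kap ^+ 2] `&`
   [set y : Omega | noise z0 (fun k => (y (inr k, true) +i* y (inr k, false))%C - hq k) <= 32 * kap ^+ 2] by [].
by apply: measurableI; [exact: (mn hp inl) | exact: (mn hq inr)].
Qed.

(** On [E] the coefficients shifted by the peaks are in the good set, and the
    weight of the shift is at least exp(- log_cost). *)
Lemma good_set_prob :
  ((expR (- log_cost) / 2)%:E <= P ((fun w => (fun k => coordinate k w) : Omega) @^-1` good_set))%E.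
Proof.
have cE i w : (coordinate (i, true) w +i* coordinate (i, false) w)%C = Z i w.
  by rewrite /coordinate /=; case: (Z i w).
apply: (@le_trans _ _ ((expR (- log_cost))%:E * P E)%E).
  by rewrite EFinM lee_wpmul2l// lee_fin expR_ge0.
apply: (@shifted_event_prob R d T P _ coordinate (fun k => s k.1) measurable_coordinate _ coordinate_rect shift) => //.
- by move=> k; rewrite gt_eqF.
- exact: measurable_good_set.
- move=> w nw; split.
    rewrite (_ : (fun k => _) = (fun k => a k w)).
      by rewrite leNgt; apply/negP => H; apply: nw; left; left; left.
    apply/funext => k; rewrite -[a k w](cE (inl k)) /shift /=.
    by case: (hp k) => x y; apply/eqP; rewrite eq_complex /= !addrK !eqxx.
  rewrite (_ : (fun k => _) = (fun k => b k w)).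
    by rewrite leNgt; apply/negP => H; apply: nw; left; left; right.
  apply/funext => k; rewrite -[b k w](cE (inr k)) /shift /=.
  by case: (hq k) => x y; apply/eqP; rewrite eq_complex /= !addrK !eqxx.
move=> w nw.
have ta : sqmod (tilt a (fun k => s (inl k)) hp w) <= 8 * 144 * energy_bound.
  by rewrite leNgt; apply/negP => H; apply: nw; left; right.
have tb : sqmod (tilt b (fun k => s (inr k)) hq w) <= 8 * 144 * energy_bound.
  by rewrite leNgt; apply/negP => H; apply: nw; right.
have Ba := tilt_bound (fun k => s0 (inl k)) var_a hpE ta.
have Bb := tilt_bound (fun k => s0 (inr k)) var_b hqE tb.
rewrite (eq_bigr (fun k => (2 * coordinate (k.1, k.2) w * shift (k.1, k.2) + shift (k.1, k.2) ^+ 2) /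
   (2 * s (k.1, k.2).1 ^+ 2))); last by case.
rewrite -(pair_bigA _ (fun i c => (2 * coordinate (i, c) w * shift (i, c) + shift (i, c) ^+ 2) / (2 * s i ^+ 2))) /=.
have Ei i : \sum_(c : bool) (2 * coordinate (i, c) w * shift (i, c) + shift (i, c) ^+ 2) / (2 * s i ^+ 2)
   = (complex.Re (Z i w) * complex.Re (peak i) + complex.Im (Z i w) * complex.Im (peak i)) / s i ^+ 2
     + sqmod (peak i) / (2 * s i ^+ 2).
  by rewrite big_bool /coordinate /shift /sqmod /=; field; rewrite gt_eqF.
under eq_bigr do rewrite Ei.
rewrite big_sumType /= !big_split /=.
by apply: le_trans (lerD Ba Bb) _; rewrite /log_cost; lra.
Qed.

Lemma good_set_sub w : good_set (fun k => coordinate k w) ->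
  good_disc (random_poly a w) (random_poly b w) z0 rho.
Proof.
move=> [Ha Hb].
have cE i : (coordinate (i, true) w +i* coordinate (i, false) w)%C = Z i w.
  by rewrite /coordinate /=; case: (Z i w).
have := good_disc_of_noise n0 rho0 rho2 kap0 kap2 Ha Hb.
have -> : coef_poly_of (fun k => (coordinate (inl k, true) w +i* coordinate (inl k, false) w)%C - hp k + hp k)
    = random_poly a w.
  by apply: eq_bigr => k _; rewrite subrK cE.
have -> // : coef_poly_of (fun k => (coordinate (inr k, true) w +i* coordinate (inr k, false) w)%C - hq k + hq k)
    = random_poly b w.
by apply: eq_bigr => k _; rewrite subrK cE.
Qed.

Lemma measurable_good_event : measurable ((fun w => (fun k => coordinate k w) : Omega) @^-1` good_set).
Proof.
rewrite -[X in measurable X]setTI.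
by have := measurable_to_Omega measurable_coordinate; apply => //; exact: measurable_good_set.
Qed.

End FixedStd.

Lemma good_event (z0 : C) (rho : R) : `|z0| <= 1 -> 0 < rho -> rho ^+ 2 = (4 * n%:R)^-1 ->
  exists G : set T, [/\ measurable G, ((expR (- log_cost) / 2)%:E <= P G)%E &
    forall w, G w -> good_disc (random_poly a w) (random_poly b w) z0 rho].
Proof.
move=> z01 rho0 rho2; have [s [s0 law]] := std_exists.
have Np : 0 < (1 + sqmod z0) ^+ n by rewrite exprn_gt0// ltr_wpDr// sqmod_ge0.
pose kap := Num.sqrt ((1 + sqmod z0) ^+ n).
have kap0 : 0 < kap by rewrite sqrtr_gt0.
have kap2 : kap ^+ 2 = (1 + sqmod z0) ^+ n by rewrite sqr_sqrtr// ltW.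
exists ((fun w => (fun k => coordinate k w)) @^-1` good_set z0 rho kap); split.
- exact: measurable_good_event.
- exact: (good_set_prob s0 law rho2 kap0 kap2).
- by move=> w; exact: good_set_sub.
Qed.

End TwoFamilies.
End GoodEvent.

(** * Grid of discs and expectation *)
Section Expectation.
Variable R : realType.
Local Notation C := (Cplx R).

(** The expected number of events that occur is the sum of their
    probabilities. *)
Lemma integral_count_ge (d : measure_display) (T : measurableType d) (P : probability T R)
  (I : finType) (G : I -> set T) (D : T -> {set I}) (f : T -> \bar R) (e : R) :
  (forall i, measurable (G i)) -> (forall i, e%:E <= P (G i))%E ->
  (forall i w, G i w -> i \in D w) -> (forall w, (#|D w|%:R)%:E <= f w)%E ->
  ((#|I|%:R * e)%:E <= \int[P]_w f w)%E.
Proof.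
move=> mG eG GD Df.
apply: (@le_trans _ _ (\int[P]_w (\sum_i (\1_(G i) w)%:E))%E); last first.
  apply: le_integral_nonmeasurable => w; first by apply: sume_ge0 => i _; rewrite lee_fin.
  apply: le_trans (Df w); rewrite sumEFin lee_fin -sum1_card natr_sum [leRHS]big_mkcond /=.
  apply: ler_sum => i _; rewrite indicE; case: (boolP (w \in G i)) => [/set_mem/GD -> //|_].
  by case: ifP.
rewrite ge0_integral_sum//; last first.
  by move=> i; apply/measurable_EFinP; exact: measurable_indic.
under eq_bigr do rewrite integral_indic// setIT.
have -> : #|I|%:R * e = \sum_(i : I) e by rewrite mulr_natl -sumr_const.
by rewrite -sumEFin; apply: lee_sum => i _; exact: eG.
Qed.

Lemma floor_sqrt (n : nat) : exists s, (s ^ 2 <= n < s.+1 ^ 2)%N.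
Proof.
have ex : exists s, (n < s.+1 ^ 2)%N.
  by exists n; rewrite -mulnn; apply: leq_pmulr.
case: (ex_minnP ex) => s Hs Hmin; exists s; rewrite Hs andbT.
case: s Hs Hmin => [//|s] _ Hmin; rewrite leqNgt; apply/negP => /Hmin; by rewrite ltnn.
Qed.

Definition grid_point (s m : nat) (i : 'I_m * 'I_m) : C :=
  ((5 / s%:R * (i.1 : nat)%:R) +i* (5 / s%:R * (i.2 : nat)%:R))%C.

Lemma normC_le_sqmod (z : C) (x : R) : 0 <= x -> sqmod z <= x ^+ 2 -> `|z| <= (x%:C)%C.
Proof.
by move=> x0; rewrite -cabs_sq -cabsE lecR ler_pXn2r// nnegrE cabs_ge0.
Qed.

(** Coordinates are at most 5/8, and 2 (5/8)^2 <= 1. *)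
Lemma grid_point_le1 (s : nat) (i : 'I_(s %/ 8).+1 * 'I_(s %/ 8).+1) : (0 < s)%N ->
  `|grid_point s i| <= 1.
Proof.
move=> s0; apply: (normC_le_sqmod ler01).
have sR : (0 : R) < s%:R by rewrite ltr0n.
have H (k : 'I_(s %/ 8).+1) : 0 <= 5 / s%:R * (k : nat)%:R :> R /\ 5 / s%:R * (k : nat)%:R <= 5 / 8 :> R.
  split; first by rewrite mulr_ge0// divr_ge0.
  rewrite mulrAC ler_pdivrMr//.
  have : (8 * k <= s)%N by have := ltn_ord k; rewrite ltnS leq_divRL// mulnC.
  by rewrite -(ler_nat R) natrM; lra.
by case: i => j k; rewrite /sqmod /=; have [? ?] := H j; have [? ?] := H k; nra.
Qed.

Lemma nat_sqr_dist (j k : nat) : j != k -> (1 : R) <= (j%:R - k%:R) ^+ 2.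
Proof.
move=> jk; wlog lt : j k jk / (j < k)%N => [H|].
  case: (ltngtP j k) jk => // kj _; first by apply: H => //; rewrite ltn_eqF.
  by rewrite -sqrrN opprB; apply: H => //; rewrite ltn_eqF.
have : (j%:R : R) + 1 <= k%:R by rewrite natr1 ler_nat.
by nra.
Qed.

(** The mesh 5/s is at least 5/sqrt n, while 8 rho = 4/sqrt n. *)
Lemma grid_point_separated (n s m : nat) (rho : R) (i j : 'I_m * 'I_m) :
  (0 < s)%N -> (s ^ 2 <= n)%N -> 0 < rho -> rho ^+ 2 = (4 * n%:R)^-1 -> i != j ->
  ((8 * rho)%:C)%C < `|grid_point s i - grid_point s j|.
Proof.
move=> s0 sn rho0 rho2 ij.
have sR : (0 : R) < s%:R by rewrite ltr0n.
have nR : (0 : R) < n%:R by rewrite ltr0n (leq_trans _ sn)// expn_gt0 s0.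
rewrite -cabsE ltcR -(@ltr_pXn2r _ 2)// ?nnegrE ?cabs_ge0//; last by rewrite mulr_ge0// ltW.
rewrite cabs_sq exprMn rho2.
have -> : 8 ^+ 2 * (4 * n%:R)^-1 = 16 / n%:R :> R by field; rewrite gt_eqF.
apply: (@lt_le_trans _ _ (25 / s%:R ^+ 2)).
  rewrite ltr_pdivrMr// mulrAC ltr_pdivlMr ?exprn_gt0//.
  have : s%:R ^+ 2 <= n%:R :> R by rewrite -natrX ler_nat.
  by nra.
have -> : sqmod (grid_point s i - grid_point s j) = 25 / s%:R ^+ 2 *
    (((i.1 : nat)%:R - (j.1 : nat)%:R) ^+ 2 + ((i.2 : nat)%:R - (j.2 : nat)%:R) ^+ 2).
  by rewrite /sqmod /grid_point /=; field; rewrite gt_eqF.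
rewrite ler_peMr//.
case: i j ij => i1 i2 [j1 j2] /=; rewrite xpair_eqE negb_and => /orP[] /nat_sqr_dist h.
  by rewrite ler_wpDr// sqr_ge0.
by rewrite ler_wpDl// sqr_ge0.
Qed.

End Expectation.

Theorem corollary11 (R : realType) :
  exists2 c1 : R, 0 < c1 &
    forall (n : nat), (1 <= n)%N ->
    forall (d : measure_display) (T : measurableType d) (P : probability T R)
           (a b : 'I_n.+1 -> T -> Cplx R),
      (forall k, centered_complex_gaussian P (a k)) ->
      (forall k, centered_complex_gaussian P (b k)) ->
      mutually_independent P (family_pair a b) ->
      (forall j k, complex_expectation P (fun w => a j w * Num.conj (a k w))
                   = if j == k then ('C(n, k))%:R else 0) ->
      (forall j k, complex_expectation P (fun w => b j w * Num.conj (b k w))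
                   = if j == k then ('C(n, k))%:R else 0) ->
      let Gamma := fun w : T => lemniscate (random_poly a w) (random_poly b w) in
      ((c1 * n%:R)%:E <= \int[P]_w num_components R (Gamma w))%E /\
      (\int[P]_w num_components R (Gamma w) <= (n%:R)%:E)%E.
Proof.
exists (expR (- log_cost R) / 2 / 64); first by rewrite !divr_gt0// expR_gt0.
move=> n n0 d T P a b ga gb ind ca cb Gamma.
have sz (c : 'I_n.+1 -> T -> Cplx R) w : (size (random_poly c w) <= n.+1)%N.
  apply: (leq_trans (size_sum _ _ _)); apply/bigmax_leqP => k _.
  by apply: (leq_trans (size_scale_leq _ _)); rewrite size_polyXn.
have nc0 w : (0 <= num_components R (Gamma w))%E by rewrite /num_components /counting; case: ifP.
split; last first.
  apply: (@le_trans _ _ (\int[P]_w (n%:R)%:E)%E).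
    by apply: le_integral_nonmeasurable => // w; apply: lemniscate_num_components_le.
  by rewrite integral_cst// [X in (_ * X)%E](_ : _ = 1%E) ?mule1//; exact: probability_setT.
have [s /andP[sn ns]] := floor_sqrt n.
have s0 : (0 < s)%N by case: s sn ns => // _; rewrite ltnNge n0.
pose rho : R := Num.sqrt (4 * n%:R)^-1.
have rho0 : 0 < rho by rewrite sqrtr_gt0 invr_gt0 mulr_gt0// ltr0n.
have rho2 : rho ^+ 2 = (4 * n%:R)^-1 by rewrite sqr_sqrtr// invr_ge0 mulr_ge0.
(* The grid has m^2 points of mesh 5/s, with s the integer part of sqrt n;
   64 m^2 >= (s + 1)^2 > n. *)
pose m := (s %/ 8).+1.
have /choice[G HG] : forall i : 'I_m * 'I_m, exists G : set T, [/\ measurable G,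
    ((expR (- log_cost R) / 2)%:E <= P G)%E &
    forall w, G w -> good_disc (random_poly a w) (random_poly b w) (grid_point R s i) rho].
  by move=> i; apply: good_event => //; exact: grid_point_le1.
pose D w := [set i | w \in G i]%SET.
have mn : (n <= 64 * (m * m))%N.
  have sm : (s.+1 <= 8 * m)%N by rewrite /m mulnC ltn_ceil.
  apply: leq_trans (ltnW ns) _; rewrite (_ : 64 * (m * m) = (8 * m) ^ 2)%N ?leq_exp2r//.
  by rewrite expnMn.
have count : expR (- log_cost R) / 2 / 64 * n%:R <= #|{: 'I_m * 'I_m}|%:R * (expR (- log_cost R) / 2).
  rewrite card_prod !card_ord.
  have c0 : 0 < expR (- log_cost R) / 2 by rewrite divr_gt0// expR_gt0.
  have : n%:R <= 64 * (m * m)%:R :> R by rewrite -natrM ler_nat.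
  by move: c0; move: (expR _ / 2) (n%:R) ((m * m)%:R) => x y z; nra.
apply: (@le_trans _ _ (#|{: 'I_m * 'I_m}|%:R * (expR (- log_cost R) / 2))%:E).
  by rewrite lee_fin.
apply: (@integral_count_ge _ _ _ _ _ G D) => [i|i|i w Gw|w]; try by have [] := HG i.
  by rewrite inE mem_set.
apply: (num_components_ge_good rho0 (rho_le_half n0 rho0 rho2) (fun i => grid_point_le1 R i s0)).
  by move=> i j; exact: (grid_point_separated s0 sn rho0 rho2).
by move=> i; rewrite inE => /set_mem Gi; have [_ _] := HG i; apply.
Qed.
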